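(* Let $N\ge 1$ be an integer and let $h\in\mathcal{P}_2$. The following are equivalent: (1) $h\in\mathcal{L}^{N}$. (2) $h\in\mathcal{L}^{N-}$ and there are complex numbers (not necessarily real) $(\rho_n)_{|n|\le 2N-1}$ such that $$h(z)=\sum_{|n|\le 2N-1}\frac{\rho_n}{z^n}+o\left(\frac{1}{\|z\|^{2N-1}}\right)$$ nontangentially.
   Context: $\Pi$ is the open upper half plane in $\mathbb{C}$, and $\mathcal{P}_2$ is the set of holomorphic functions from $\Pi^2$ to $\Pi$. Multi-indices $n=(n_1,n_2)$ are pairs of non-negative integers, $|n|=n_1+n_2$, $z^n=z_1^{n_1}z_2^{n_2}$. Nontangential asymptotics: an asymptotic formula holds nontangentially (at $\infty$) if for each $c\in\mathbb{R}$ it holds for all $z\in\Pi^2$ large enough satisfying $\|z\|\le c\,\min\{\mathrm{Im}(z_1),\mathrm{Im}(z_2)\}$ (i.e. the $o$ or $O$ estimate holds as $\|z\|\to\infty$ within this region, for each $c$). Löwner class $\mathcal{L}^N$: the set of $h\in\mathcal{P}_2$ such that $\lim_{s\to\infty}h(is,is)=0$ and there are real numbers $(\rho_n)_{|n|\le 2N-1}$ with $h(z)=\sum_{|n|\le 2N-1}\frac{\rho_n}{z^n}+o\left(\frac{1}{\|z\|^{2N-1}}\right)$ nontangentially. Intermediate Löwner class $\mathcal{L}^{N-}$: the set of $h\in\mathcal{P}_2$ such that $\lim_{s\to\infty}h(is,is)=0$ and there are real numbers $(\rho_n)_{|n|\le 2N-2}$ with $h(z)=\sum_{|n|\le 2N-2}\frac{\rho_n}{z^n}+O\left(\frac{1}{\|z\|^{2N-1}}\right)$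 nontangentially. *)

(* Defs.v *)
From Stdlib Require Import Reals.
From Coquelicot Require Import Coquelicot.

Open Scope R_scope.

Definition C2 : NormedModule C_AbsRing :=
  prod_NormedModule C_AbsRing C_NormedModule C_NormedModule.

(* Coquelicot's norm on a product is the Euclidean one,
   sqrt (|z1| ^ 2 + |z2| ^ 2). *)
Definition norm2 (z : C2) : R := norm z.

Definition upper (w : C) : Prop := 0 < Im w.

Definition upper2 (z : C2) : Prop := upper (fst z) /\ upper (snd z).

(* A function on Pi^2 is a total function on C^2 whose values outside Pi^2
   are never used.  [ex_filterdiff] over the scalars C asks for a complex
   linear Frechet derivative, so this is holomorphy in two variables. *)
Definition Pick2 (h : C2 -> C) : Prop :=
  forall z : C2, upper2 z ->
    upper (h z) /\
    ex_filterdiff (K := C_AbsRing) (U := C2) (V := C_NormedModule) h (locally z).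

Definition monomial (z : C2) (n : nat * nat) : C :=
  (Cpow (fst z) (fst n) * Cpow (snd z) (snd n))%C.

(* Sum of rho_n / z^n over the multi-indices n = (j, k - j) with
   0 <= j <= k <= m; the other values of rho are irrelevant. *)
Definition expansion (rho : nat * nat -> C) (m : nat) (z : C2) : C :=
  sum_n (fun k : nat =>
    sum_n (fun j : nat =>
      (rho (j, (k - j)%nat) / monomial z (j, (k - j)%nat))%C) k) m.

Definition nontangential_region (c : R) (z : C2) : Prop :=
  upper2 z /\ norm2 z <= c * Rmin (Im (fst z)) (Im (snd z)).

Definition at_infinity (P : C2 -> Prop) : Prop :=
  exists M : R, forall z : C2, M < norm2 z -> P z.

Definition nontangential (c : R) : (C2 -> Prop) -> Prop :=
  within (nontangential_region c) at_infinity.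

(* f(z) = o(1 / ||z||^m) nontangentially. *)
Definition nt_littleo (f : C2 -> C) (m : nat) : Prop :=
  forall c : R,
    is_domin (Ku := R_AbsRing) (Kv := C_AbsRing)
      (U := R_NormedModule) (V := C_NormedModule)
      (nontangential c) (fun z : C2 => 1 / norm2 z ^ m) f.

(* f(z) = O(1 / ||z||^m) nontangentially; the constant may depend on c. *)
Definition nt_bigO (f : C2 -> C) (m : nat) : Prop :=
  forall c : R, exists K : R,
    nontangential c (fun z : C2 => Cmod (f z) <= K * (1 / norm2 z ^ m)).

Definition vanishes_at_i_infinity (h : C2 -> C) : Prop :=
  filterlim (fun s : R => h (Ci * RtoC s, Ci * RtoC s)%C)
    (Rbar_locally p_infty) (locally (RtoC 0)).

Definition Loewner (N : nat) (h : C2 -> C) : Prop :=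
  Pick2 h /\ vanishes_at_i_infinity h /\
  exists rho : nat * nat -> R,
    nt_littleo
      (fun z => (h z - expansion (fun n => RtoC (rho n)) (2 * N - 1) z)%C)
      (2 * N - 1).

Definition LoewnerMinus (N : nat) (h : C2 -> C) : Prop :=
  Pick2 h /\ vanishes_at_i_infinity h /\
  exists rho : nat * nat -> R,
    nt_bigO
      (fun z => (h z - expansion (fun n => RtoC (rho n)) (2 * N - 2) z)%C)
      (2 * N - 1).

(* Main.v *)
Require Import Defs.
From Stdlib Require Import Reals.
From Coquelicot Require Import Coquelicot.
From Stdlib Require Import Lra Lia Classical ClassicalEpsilon.

(** From left to right, only the terms of degree [2N-1] are dropped, which are
    [O(1/||z||^(2N-1))] in a nontangential region because there both
    coordinates are comparable to [||z||] ([expansion_truncate]).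

    From right to left, everything happens on the lines [z |-> (z/t, z)],
    [t > 0], which map the upper half plane [Pi] into [Pi^2] and cones into
    nontangential regions.  On such a line the expansion of [h] becomes
    [sum_k R_k(t) / z^k], where [R_k] is a polynomial in [t] whose
    coefficients are the [rho_n] with [|n| = k].  So it is enough that every
    [R_k(t)] is real ([coefficients_real]).  For [k <= 2N-2] this holds by
    uniqueness of asymptotic expansions, since the intermediate class
    provides a real expansion up to that order ([homogeneous_part_unique]).
    The remaining [R_(2N-1)(t)] is a statement about one variable, in the
    spirit of Hamburger's theorem: if [f] is holomorphic on [Pi] with
    [Im f >= 0] and
    [f = r_1/z + ... + r_(2n)/z^(2n) + rho/z^(2n+1) + o(1/z^(2n+1))]
    nontangentially, with real [r_k], then [rho] is real
    ([hamburger_last_coefficient_real]).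

    With the Nevanlinna representation of [f] by a measure [mu], passing
    from [f] to [z^2 f - r_1 z - r_2] replaces [mu] by [t^2 mu], so this
    operation preserves [Im >= 0] and lowers [n] by one; for [n = 0] the
    claim follows by looking at [Im (rho/z)] as [z] approaches the two real
    half-lines ([residue_real]).  Here the representation is avoided.  The
    Julia inequality [y |f|^2 <= - r_1 Im f] ([julia]) plays the role of the
    Cauchy-Schwarz inequality for [mu]: it yields
    [Im (z^2 f - r_1 z - r_2) >= - K y] on all of [Pi].  A Phragmen-Lindelof
    principle ([phragmen_lindelof]) improves such a bound to [Im >= 0] when
    the function is moreover [o(z)] in cones ([im_nonneg_moment_shift]); the
    same principle, applied to [-1/f + z/r_1], proves the Julia inequality.

    The Phragmen-Lindelof principle rests on a minimum principle for
    imaginary parts of functions that are merely complex differentiable.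
    This requires Goursat's theorem, proved for closed real one-forms on
    rectangles by bisection ([goursat]); in logarithmic polar coordinates it
    says that circle means do not depend on the radius
    ([circle_integral_const]). *)

Open Scope R_scope.

(** * Goursat's theorem for closed forms on rectangles *)

Definition circulation (P Q : R -> R -> R) (x y w h : R) : R :=
  RInt (fun s => P s y) x (x + w) - RInt (fun s => P s (y + h)) x (x + w)
  + RInt (fun t => Q (x + w) t) y (y + h) - RInt (fun t => Q x t) y (y + h).

(** The equality of the two middle partial derivatives is the closedness of
    [P dx + Q dy]; pointwise differentiability is the regularity that complex
    differentiability provides. *)
Definition closed_form_at (P Q : R -> R -> R) (x y : R) : Prop :=
  exists a b d, differentiable_pt_lim P x y a b /\ differentiable_pt_lim Q x y b d.

Definition closed_form_on (P Q : R -> R -> R) (x y w h : R) : Prop :=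
  forall s t, x <= s <= x + w -> y <= t <= y + h -> closed_form_at P Q s t.

Lemma differentiable_pt_lim_continuous_fst (P : R -> R -> R) x y a b :
  differentiable_pt_lim P x y a b -> continuous (fun s => P s y) x.
Proof.
  intros H.
  apply continuity_pt_filterlim.
  assert (H' : continuity_2d_pt P x y)
    by (apply differentiable_continuity_pt; exists a, b; exact H).
  intros eps Heps.
  destruct (H' (mkposreal eps Heps)) as [d Hd].
  exists d; split; [apply cond_pos|].
  intros s [_ Hs]. apply Hd; [exact Hs|].
  rewrite Rminus_diag, Rabs_R0. apply cond_pos.
Qed.

Lemma differentiable_pt_lim_continuous_snd (P : R -> R -> R) x y a b :
  differentiable_pt_lim P x y a b -> continuous (fun t => P x t) y.
Proof.
  intros H.
  apply continuity_pt_filterlim.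
  assert (H' : continuity_2d_pt P x y)
    by (apply differentiable_continuity_pt; exists a, b; exact H).
  intros eps Heps.
  destruct (H' (mkposreal eps Heps)) as [d Hd].
  exists d; split; [apply cond_pos|].
  intros s [_ Hs]. apply Hd; [|exact Hs].
  rewrite Rminus_diag, Rabs_R0. apply cond_pos.
Qed.

Lemma closed_form_ex_RInt_P P Q x y w h s1 s2 t :
  closed_form_on P Q x y w h -> x <= s1 -> s1 <= s2 -> s2 <= x + w ->
  y <= t <= y + h -> ex_RInt (fun s => P s t) s1 s2.
Proof.
  intros H H1 H2 H3 Ht. apply (ex_RInt_continuous (V := R_CompleteNormedModule)). intros z.
  rewrite Rmin_left, Rmax_right by lra. intros Hz.
  destruct (H z t) as (a & b & d & HP & _); [lra|lra|].
  eapply differentiable_pt_lim_continuous_fst, HP.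
Qed.

Lemma closed_form_ex_RInt_Q P Q x y w h s t1 t2 :
  closed_form_on P Q x y w h -> y <= t1 -> t1 <= t2 -> t2 <= y + h ->
  x <= s <= x + w -> ex_RInt (fun t => Q s t) t1 t2.
Proof.
  intros H H1 H2 H3 Hs. apply (ex_RInt_continuous (V := R_CompleteNormedModule)). intros z.
  rewrite Rmin_left, Rmax_right by lra. intros Hz.
  destruct (H s z) as (a & b & d & _ & HQ); [lra|lra|].
  eapply differentiable_pt_lim_continuous_snd, HQ.
Qed.

Lemma circulation_quarters P Q x y w h :
  0 <= w -> 0 <= h -> closed_form_on P Q x y w h ->
  circulation P Q x y w h =
    circulation P Q x y (w / 2) (h / 2)
    + circulation P Q (x + w / 2) y (w / 2) (h / 2)
    + circulation P Q x (y + h / 2) (w / 2) (h / 2)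
    + circulation P Q (x + w / 2) (y + h / 2) (w / 2) (h / 2).
Proof.
  intros Hw Hh HC. unfold circulation.
  replace (x + w / 2 + w / 2) with (x + w) by field.
  replace (y + h / 2 + h / 2) with (y + h) by field.
  assert (EP : forall t, y <= t <= y + h ->
    RInt (fun s => P s t) x (x + w) =
    RInt (fun s => P s t) x (x + w / 2) + RInt (fun s => P s t) (x + w / 2) (x + w)).
  { intros t Ht. symmetry.
    apply (RInt_Chasles (V := R_CompleteNormedModule) (fun s => P s t));
      eapply closed_form_ex_RInt_P; try apply HC; lra. }
  assert (EQ : forall s, x <= s <= x + w ->
    RInt (fun t => Q s t) y (y + h) =
    RInt (fun t => Q s t) y (y + h / 2) + RInt (fun t => Q s t) (y + h / 2) (y + h)).
  { intros s Hs. symmetry.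
    apply (RInt_Chasles (V := R_CompleteNormedModule) (fun t => Q s t));
      eapply closed_form_ex_RInt_Q; try apply HC; lra. }
  rewrite (EP y), (EP (y + h)), (EQ x), (EQ (x + w)) by lra. ring.
Qed.

(** The linear part of a closed form is exact, so its circulation vanishes and
    only the remainders contribute. *)
Lemma circulation_local_bound P Q x y w h l m a b d e D :
  0 <= w -> 0 <= h -> closed_form_on P Q x y w h ->
  (forall s t, x <= s <= x + w -> y <= t <= y + h ->
     Rabs (P s t - P l m - (a * (s - l) + b * (t - m))) <= e * D) ->
  (forall s t, x <= s <= x + w -> y <= t <= y + h ->
     Rabs (Q s t - Q l m - (b * (s - l) + d * (t - m))) <= e * D) ->
  Rabs (circulation P Q x y w h) <= 2 * (w + h) * (e * D).
Proof.
  intros Hw Hh HC HP HQ. unfold circulation.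
  set (I1 := RInt (fun s => P s y) x (x + w)).
  set (I2 := RInt (fun s => P s (y + h)) x (x + w)).
  set (I3 := RInt (fun t => Q (x + w) t) y (y + h)).
  set (I4 := RInt (fun t => Q x t) y (y + h)).
  assert (E1 : Rabs (I1 - I2 + b * h * w) <= w * (2 * (e * D))).
  { replace (I1 - I2 + b * h * w) with
      (RInt (fun s => P s y - P s (y + h) + b * h) x (x + w)).
    - replace (w * (2 * (e * D))) with ((x + w - x) * (2 * (e * D))) by ring.
      apply abs_RInt_le_const; [lra| |].
      + apply (ex_RInt_plus (V := R_NormedModule) (fun s => P s y - P s (y + h)) (fun _ => b * h));
          [|apply ex_RInt_const].
        apply (ex_RInt_minus (V := R_NormedModule) (fun s => P s y) (fun s => P s (y + h)));
          eapply closed_form_ex_RInt_P; try apply HC; lra.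
      + intros s Hs.
        assert (A1 := HP s y Hs ltac:(lra)). assert (A2 := HP s (y + h) Hs ltac:(lra)).
        apply Rabs_le_between in A1, A2. apply Rabs_le. lra.
    - rewrite (RInt_plus (V := R_CompleteNormedModule) (fun s => P s y - P s (y + h)) (fun _ => b * h)).
      + rewrite (RInt_minus (V := R_CompleteNormedModule) (fun s => P s y) (fun s => P s (y + h))).
        * rewrite RInt_const. unfold plus, minus, opp, scal; simpl; unfold plus, opp, mult; simpl.
          unfold mult; simpl. fold I1 I2. ring.
        * eapply closed_form_ex_RInt_P; try apply HC; lra.
        * eapply closed_form_ex_RInt_P; try apply HC; lra.
      + apply (ex_RInt_minus (V := R_NormedModule) (fun s => P s y) (fun s => P s (y + h)));
          eapply closed_form_ex_RInt_P; try apply HC; lra.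
      + apply ex_RInt_const. }
  assert (E2 : Rabs (I3 - I4 + - (b * w) * h) <= h * (2 * (e * D))).
  { replace (I3 - I4 + - (b * w) * h) with
      (RInt (fun t => Q (x + w) t - Q x t + - (b * w)) y (y + h)).
    - replace (h * (2 * (e * D))) with ((y + h - y) * (2 * (e * D))) by ring.
      apply abs_RInt_le_const; [lra| |].
      + apply (ex_RInt_plus (V := R_NormedModule) (fun t => Q (x + w) t - Q x t) (fun _ => - (b * w)));
          [|apply ex_RInt_const].
        apply (ex_RInt_minus (V := R_NormedModule) (fun t => Q (x + w) t) (fun t => Q x t));
          eapply closed_form_ex_RInt_Q; try apply HC; lra.
      + intros t Ht.
        assert (A1 := HQ x t ltac:(lra) Ht). assert (A2 := HQ (x + w) t ltac:(lra) Ht).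
        apply Rabs_le_between in A1, A2. apply Rabs_le. lra.
    - rewrite (RInt_plus (V := R_CompleteNormedModule) (fun t => Q (x + w) t - Q x t) (fun _ => - (b * w))).
      + rewrite (RInt_minus (V := R_CompleteNormedModule) (fun t => Q (x + w) t) (fun t => Q x t)).
        * rewrite RInt_const. unfold plus, minus, opp, scal; simpl; unfold plus, opp, mult; simpl.
          unfold mult; simpl. fold I3 I4. ring.
        * eapply closed_form_ex_RInt_Q; try apply HC; lra.
        * eapply closed_form_ex_RInt_Q; try apply HC; lra.
      + apply (ex_RInt_minus (V := R_NormedModule) (fun t => Q (x + w) t) (fun t => Q x t));
          eapply closed_form_ex_RInt_Q; try apply HC; lra.
      + apply ex_RInt_const. }
  apply Rabs_le_between in E1, E2. apply Rabs_le. nra.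
Qed.

Lemma nested_intervals (x : nat -> R) (w : R) :
  (forall n, x n <= x (S n) /\ x (S n) + w / 2 ^ S n <= x n + w / 2 ^ n) ->
  exists l, forall n, x n <= l <= x n + w / 2 ^ n.
Proof.
  intros H.
  assert (Hinc : forall n k, x n <= x (n + k)%nat).
  { intros n k. induction k as [|k IH]; [rewrite Nat.add_0_r; lra|].
    rewrite Nat.add_succ_r. destruct (H (n + k)%nat). lra. }
  assert (Hdec : forall n k, x (n + k)%nat + w / 2 ^ (n + k) <= x n + w / 2 ^ n).
  { intros n k. induction k as [|k IH]; [rewrite Nat.add_0_r; lra|].
    rewrite Nat.add_succ_r. destruct (H (n + k)%nat). lra. }
  assert (Hw : 0 <= w).
  { destruct (H O) as [H1 H2]. simpl in H2. lra. }
  assert (Hpos : forall n, 0 <= w / 2 ^ n).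
  { intros n. apply Rdiv_le_0_compat; [lra|]. apply pow_lt; lra. }
  assert (Hub : forall n k, x k <= x n + w / 2 ^ n).
  { intros n k. destruct (Nat.le_ge_cases n k) as [L|L].
    - replace k with (n + (k - n))%nat by lia.
      generalize (Hdec n (k - n)%nat) (Hpos (n + (k - n))%nat). lra.
    - replace n with (k + (n - k))%nat by lia.
      generalize (Hinc k (n - k)%nat) (Hpos (k + (n - k))%nat). lra. }
  destruct (completeness (fun v => exists n, v = x n)) as [l [Hl1 Hl2]].
  - exists (x O + w / 2 ^ 0). intros v [n ->]. apply Hub.
  - exists (x O), O. reflexivity.
  - exists l. intros n. split.
    + apply Hl1. exists n. reflexivity.
    + apply Hl2. intros v [k ->]. apply Hub.
Qed.

(** A property inherited by some quarter of each rectangle accumulates at a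
    point.  Both Goursat's theorem and the existence of minima follow by
    choosing what counts as a bad rectangle. *)
Lemma bisection (Bad : R -> R -> R -> R -> Prop) (x y w h : R) :
  0 <= w -> 0 <= h ->
  (forall a b p q, 0 <= p -> 0 <= q -> Bad a b p q ->
     exists a' b', (a' = a \/ a' = a + p / 2) /\ (b' = b \/ b' = b + q / 2) /\
       Bad a' b' (p / 2) (q / 2)) ->
  Bad x y w h ->
  exists l m, x <= l <= x + w /\ y <= m <= y + h /\
    forall d, 0 < d -> exists a b p q, Bad a b p q /\ 0 <= p /\ 0 <= q /\ p + q < d /\
      x <= a /\ a + p <= x + w /\ y <= b /\ b + q <= y + h /\
      a <= l <= a + p /\ b <= m <= b + q.
Proof.
  intros Hw Hh Hstep HB.
  assert (Hp2 : forall n, 0 < 2 ^ n) by (intros n; apply pow_lt; lra).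
  assert (Hwn : forall n, 0 <= w / 2 ^ n) by (intros; apply Rdiv_le_0_compat; auto).
  assert (Hhn : forall n, 0 <= h / 2 ^ n) by (intros; apply Rdiv_le_0_compat; auto).
  assert (Ew : forall n, w / 2 ^ S n = w / 2 ^ n / 2) by (intros; simpl; field; apply pow_nonzero; lra).
  assert (Eh : forall n, h / 2 ^ S n = h / 2 ^ n / 2) by (intros; simpl; field; apply pow_nonzero; lra).
  assert (step : forall (n : nat) (p : R * R), exists q : R * R,
    Bad (fst p) (snd p) (w / 2 ^ n) (h / 2 ^ n) ->
    Bad (fst q) (snd q) (w / 2 ^ S n) (h / 2 ^ S n) /\
    (fst q = fst p \/ fst q = fst p + w / 2 ^ S n) /\
    (snd q = snd p \/ snd q = snd p + h / 2 ^ S n)).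
  { intros n p.
    destruct (classic (Bad (fst p) (snd p) (w / 2 ^ n) (h / 2 ^ n))) as [Hok|Hno]; [|exists p; tauto].
    destruct (Hstep _ _ _ _ (Hwn n) (Hhn n) Hok) as (a' & b' & A1 & A2 & A3).
    exists (a', b'). rewrite Ew, Eh. simpl. auto. }
  pose (next := fun n p => proj1_sig (constructive_indefinite_description _ (step n p))).
  pose (c := fix c n := match n with O => (x, y) | S n => next n (c n) end).
  assert (Hnext : forall n, Bad (fst (c n)) (snd (c n)) (w / 2 ^ n) (h / 2 ^ n) ->
    Bad (fst (c (S n))) (snd (c (S n))) (w / 2 ^ S n) (h / 2 ^ S n) /\
    (fst (c (S n)) = fst (c n) \/ fst (c (S n)) = fst (c n) + w / 2 ^ S n) /\
    (snd (c (S n)) = snd (c n) \/ snd (c (S n)) = snd (c n) + h / 2 ^ S n)).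
  { intros n. exact (proj2_sig (constructive_indefinite_description _ (step n (c n)))). }
  assert (Hbad : forall n, Bad (fst (c n)) (snd (c n)) (w / 2 ^ n) (h / 2 ^ n)).
  { induction n as [|n IH]; [simpl; rewrite !Rdiv_1_r; exact HB|apply Hnext, IH]. }
  assert (Hsub : forall n, x <= fst (c n) /\ fst (c n) + w / 2 ^ n <= x + w /\
    y <= snd (c n) /\ snd (c n) + h / 2 ^ n <= y + h).
  { induction n as [|n IH]; [simpl; rewrite !Rdiv_1_r; lra|].
    destruct (Hnext n (Hbad n)) as (_ & B1 & B2). rewrite Ew, Eh in *.
    generalize (Hwn n) (Hhn n). intros. destruct B1, B2; lra. }
  destruct (nested_intervals (fun n => fst (c n)) w) as [l Hl].
  { intros n. destruct (Hnext n (Hbad n)) as (_ & B & _). rewrite Ew in *.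
    generalize (Hwn n). cbv beta. destruct B; lra. }
  destruct (nested_intervals (fun n => snd (c n)) h) as [m Hm].
  { intros n. destruct (Hnext n (Hbad n)) as (_ & _ & B). rewrite Eh in *.
    generalize (Hhn n). cbv beta. destruct B; lra. }
  exists l, m. repeat split.
  1-2: generalize (Hl O); simpl; rewrite Rdiv_1_r; lra.
  1-2: generalize (Hm O); simpl; rewrite Rdiv_1_r; lra.
  intros d Hd.
  destruct (pow_lt_1_zero (/ 2) ltac:(rewrite Rabs_pos_eq; lra) (d / (w + h + 1))) as [n Hn].
  { apply Rdiv_lt_0_compat; lra. }
  specialize (Hn n (Nat.le_refl n)).
  rewrite pow_inv, Rabs_pos_eq in Hn by (left; apply Rinv_0_lt_compat, Hp2).
  apply Rmult_lt_compat_l with (r := w + h + 1) in Hn; [|lra].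
  replace ((w + h + 1) * (d / (w + h + 1))) with d in Hn by (field; lra).
  exists (fst (c n)), (snd (c n)), (w / 2 ^ n), (h / 2 ^ n).
  specialize (Hl n). specialize (Hm n). specialize (Hsub n). cbv beta in Hl, Hm.
  assert (0 < / 2 ^ n) by apply Rinv_0_lt_compat, Hp2.
  repeat split; try apply Hbad; try apply Hwn; try apply Hhn; try tauto.
  unfold Rdiv. lra.
Qed.

(** A nonzero circulation stays at least proportional to the squared size of
    the rectangle on some quarter, hence on arbitrarily small rectangles
    around one point, where differentiability makes it smaller than that. *)
Lemma goursat P Q x y w h :
  0 <= w -> 0 <= h -> closed_form_on P Q x y w h -> circulation P Q x y w h = 0.
Proof.
  intros Hw Hh HC.
  destruct (Req_dec (circulation P Q x y w h) 0) as [E|NE]; [exact E|exfalso].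
  apply Rabs_pos_lt in NE.
  assert (HS : 0 <= (w + h) ^ 2) by apply pow2_ge_0.
  pose (k := Rabs (circulation P Q x y w h) / ((w + h) ^ 2 + 1)).
  assert (Hk : 0 < k) by (apply Rdiv_lt_0_compat; lra).
  destruct (bisection (fun a b p q =>
    closed_form_on P Q a b p q /\ k * (p + q) ^ 2 < Rabs (circulation P Q a b p q)) x y w h Hw Hh)
    as (l & m & Hl & Hm & Hlim).
  - intros a b p q Hp Hq [HC' Hbig].
    rewrite (circulation_quarters P Q a b p q Hp Hq HC') in Hbig.
    set (c1 := circulation P Q a b (p / 2) (q / 2)) in *.
    set (c2 := circulation P Q (a + p / 2) b (p / 2) (q / 2)) in *.
    set (c3 := circulation P Q a (b + q / 2) (p / 2) (q / 2)) in *.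
    set (c4 := circulation P Q (a + p / 2) (b + q / 2) (p / 2) (q / 2)) in *.
    assert (T1 := Rabs_triang (c1 + c2 + c3) c4). assert (T2 := Rabs_triang (c1 + c2) c3).
    assert (T3 := Rabs_triang c1 c2).
    replace (k * (p + q) ^ 2) with (4 * (k * (p / 2 + q / 2) ^ 2)) in Hbig by field.
    set (k' := k * (p / 2 + q / 2) ^ 2) in *.
    assert (sub : forall a' b', (a' = a \/ a' = a + p / 2) -> (b' = b \/ b' = b + q / 2) ->
      closed_form_on P Q a' b' (p / 2) (q / 2)).
    { intros a' b' Ha Hb s t Hs Ht. apply HC'; destruct Ha, Hb; lra. }
    destruct (Rlt_le_dec k' (Rabs c1)); [exists a, b; repeat split; auto|].
    destruct (Rlt_le_dec k' (Rabs c2)); [exists (a + p / 2), b; repeat split; auto|].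
    destruct (Rlt_le_dec k' (Rabs c3)); [exists a, (b + q / 2); repeat split; auto|].
    destruct (Rlt_le_dec k' (Rabs c4)); [exists (a + p / 2), (b + q / 2); repeat split; auto|].
    lra.
  - split; [exact HC|]. unfold k.
    apply Rmult_lt_reg_r with ((w + h) ^ 2 + 1); [lra|].
    replace (Rabs (circulation P Q x y w h) / ((w + h) ^ 2 + 1) * (w + h) ^ 2 * ((w + h) ^ 2 + 1))
      with (Rabs (circulation P Q x y w h) * (w + h) ^ 2) by (field; lra).
    apply Rmult_lt_compat_l; lra.
  - destruct (HC l m Hl Hm) as (a & b & d & HP & HQ).
    assert (He : 0 < k / 2) by lra.
    destruct (HP (mkposreal _ He)) as [d1 Hd1]. destruct (HQ (mkposreal _ He)) as [d2 Hd2].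
    cbn [pos] in *.
    destruct (Hlim (Rmin d1 d2)) as (x' & y' & p & q & [HC' Hbig] & Hp & Hq & Hpq & Hx1 & Hx2 & Hy1 & Hy2 & Hl' & Hm').
    { apply Rmin_pos; apply cond_pos. }
    assert (Hd1' := Rmin_l d1 d2). assert (Hd2' := Rmin_r d1 d2).
    apply (Rlt_not_le _ _ Hbig).
    replace (k * (p + q) ^ 2) with (2 * (p + q) * (k / 2 * (p + q))) by (simpl; field).
    apply (circulation_local_bound P Q _ _ _ _ l m a b d); auto.
    + intros s t Hs Ht.
      assert (B1 : Rabs (s - l) <= p + q) by (apply Rabs_le; lra).
      assert (B2 : Rabs (t - m) <= p + q) by (apply Rabs_le; lra).
      eapply Rle_trans; [apply Hd1; lra|].
      apply Rmult_le_compat_l; [lra|]. apply Rmax_lub; lra.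
    + intros s t Hs Ht.
      assert (B1 : Rabs (s - l) <= p + q) by (apply Rabs_le; lra).
      assert (B2 : Rabs (t - m) <= p + q) by (apply Rabs_le; lra).
      eapply Rle_trans; [apply Hd2; lra|].
      apply Rmult_le_compat_l; [lra|]. apply Rmax_lub; lra.
Qed.

(** A rectangle is bad when its values undercut those at every point of the
    whole rectangle; bad rectangles shrink to a point of minimum. *)
Lemma rectangle_minimum (u : R -> R -> R) (x y w h : R) :
  0 <= w -> 0 <= h ->
  (forall s t, x <= s <= x + w -> y <= t <= y + h -> continuity_2d_pt u s t) ->
  exists l m, x <= l <= x + w /\ y <= m <= y + h /\
    forall s t, x <= s <= x + w -> y <= t <= y + h -> u l m <= u s t.
Proof.
  intros Hw Hh Hu.
  destruct (bisection (fun a b p q => forall s t, x <= s <= x + w -> y <= t <= y + h ->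
     exists s' t', a <= s' <= a + p /\ b <= t' <= b + q /\ u s' t' <= u s t) x y w h Hw Hh)
    as (l & m & Hl & Hm & Hlim).
  - intros a b p q Hp Hq HB. apply NNPP. intros HN.
    assert (HN' : forall a' b', (a' = a \/ a' = a + p / 2) -> (b' = b \/ b' = b + q / 2) ->
      exists s t, x <= s <= x + w /\ y <= t <= y + h /\
        forall s' t', a' <= s' <= a' + p / 2 -> b' <= t' <= b' + q / 2 -> u s t < u s' t').
    { intros a' b' Ha Hb. apply NNPP. intros HN'. apply HN. exists a', b'. repeat split; auto.
      intros s t Hs Ht. apply NNPP. intros HN''. apply HN'. exists s, t. repeat split; try lra.
      intros s' t' Hs' Ht'. apply Rnot_le_lt. intros L. apply HN''. exists s', t'. auto. }
    destruct (HN' a b) as (s1 & t1 & S1 & T1 & B1); auto.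
    destruct (HN' (a + p / 2) b) as (s2 & t2 & S2 & T2 & B2); auto.
    destruct (HN' a (b + q / 2)) as (s3 & t3 & S3 & T3 & B3); auto.
    destruct (HN' (a + p / 2) (b + q / 2)) as (s4 & t4 & S4 & T4 & B4); auto.
    assert (E : exists s t, x <= s <= x + w /\ y <= t <= y + h /\
      u s t <= u s1 t1 /\ u s t <= u s2 t2 /\ u s t <= u s3 t3 /\ u s t <= u s4 t4).
    { assert (E1 : exists s t, x <= s <= x + w /\ y <= t <= y + h /\
        u s t <= u s1 t1 /\ u s t <= u s2 t2).
      { destruct (Rle_lt_dec (u s1 t1) (u s2 t2)); [exists s1, t1|exists s2, t2]; repeat split; lra. }
      assert (E2 : exists s t, x <= s <= x + w /\ y <= t <= y + h /\
        u s t <= u s3 t3 /\ u s t <= u s4 t4).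
      { destruct (Rle_lt_dec (u s3 t3) (u s4 t4)); [exists s3, t3|exists s4, t4]; repeat split; lra. }
      destruct E1 as (s5 & t5 & ? & ? & ? & ?). destruct E2 as (s6 & t6 & ? & ? & ? & ?).
      destruct (Rle_lt_dec (u s5 t5) (u s6 t6)); [exists s5, t5|exists s6, t6]; repeat split; lra. }
    destruct E as (s & t & Hs & Ht & E1 & E2 & E3 & E4).
    destruct (HB s t Hs Ht) as (s' & t' & Hs' & Ht' & L).
    destruct (Rle_lt_dec s' (a + p / 2)), (Rle_lt_dec t' (b + q / 2)).
    + specialize (B1 s' t'). lra.
    + specialize (B3 s' t'). lra.
    + specialize (B2 s' t'). lra.
    + specialize (B4 s' t'). lra.
  - intros s t Hs Ht. exists s, t. lra.
  - exists l, m. split; [exact Hl|split; [exact Hm|]]. intros s t Hs Ht.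
    apply Rnot_lt_le. intros L.
    assert (He : 0 < u l m - u s t) by lra.
    destruct (Hu l m Hl Hm (mkposreal _ He)) as [d Hd]. cbn [pos] in Hd.
    destruct (Hlim d (cond_pos d)) as (a & b & p & q & HB & Hp & Hq & Hpq & _ & _ & _ & _ & Hl' & Hm').
    destruct (HB s t Hs Ht) as (s' & t' & Hs' & Ht' & L').
    assert (A : Rabs (u s' t' - u l m) < u l m - u s t).
    { apply Hd; apply Rabs_def1; lra. }
    apply Rabs_def2 in A. lra.
Qed.

(** * Complex derivatives and circle means *)

(** The target is seen as a module over itself so that the differentiation
    rules for products apply. *)
Definition holo_at (G : C -> C) (z : C) : Prop :=
  ex_derive (K := C_AbsRing) (V := AbsRing_NormedModule C_AbsRing) G z.

Lemma is_derive_C_epsilon (G : C -> C) (z l : C) :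
  is_derive (K := C_AbsRing) (V := AbsRing_NormedModule C_AbsRing) G z l <->
  forall eps : posreal, exists d : posreal, forall w : C, Cmod (w - z) < d ->
    Cmod (G w - G z - (w - z) * l) <= eps * Cmod (w - z).
Proof.
  split.
  - intros [_ H] eps.
    destruct (H z (fun P HP => HP) eps) as [d Hd].
    exists d. intros w Hw. exact (Hd w Hw).
  - intros H. split; [apply is_linear_scal_l|].
    intros x Hx eps.
    apply (is_filter_lim_locally_unique (V := AbsRing_NormedModule C_AbsRing)) in Hx. subst x.
    destruct (H eps) as [d Hd]. exists d. intros w Hw. exact (Hd w Hw).
Qed.

Lemma holo_const (c z : C) : holo_at (fun _ => c) z.
Proof. apply ex_derive_const. Qed.
Lemma holo_id (z : C) : holo_at (fun w => w) z.
Proof. apply ex_derive_id. Qed.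
Lemma holo_plus (F G : C -> C) (z : C) : holo_at F z -> holo_at G z -> holo_at (fun w => (F w + G w)%C) z.
Proof. apply (ex_derive_plus (K := C_AbsRing) (V := AbsRing_NormedModule C_AbsRing)). Qed.
Lemma holo_mult (F G : C -> C) (z : C) : holo_at F z -> holo_at G z -> holo_at (fun w => (F w * G w)%C) z.
Proof.
  intros [l Hl] [m Hm]. eexists.
  apply (is_derive_mult (K := C_AbsRing) F G z l m Hl Hm). exact Cmult_comm.
Qed.
Lemma is_derive_Cinv (z : C) : z <> 0%C ->
  is_derive (K := C_AbsRing) (V := AbsRing_NormedModule C_AbsRing) Cinv z (- / (z * z))%C.
Proof.
  intros Hz. apply is_derive_C_epsilon. intros eps.
  assert (Hm : 0 < Cmod z) by (apply Cmod_gt_0; exact Hz).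
  assert (He := cond_pos eps).
  assert (Hd : 0 < Rmin (Cmod z / 2) (eps * Cmod z ^ 3 / 2)).
  { apply Rmin_pos; [lra|]. apply Rdiv_lt_0_compat; [|lra]. apply Rmult_lt_0_compat; [lra|]. apply pow_lt, Hm. }
  exists (mkposreal _ Hd). intros w Hw. cbn [pos] in Hw.
  assert (H1 := Rlt_le_trans _ _ _ Hw (Rmin_l _ _)).
  assert (H2 := Rlt_le_trans _ _ _ Hw (Rmin_r _ _)).
  assert (Hw2 : Cmod z / 2 <= Cmod w).
  { assert (T := Cmod_triangle (z - w) w).
    replace (z - w + w)%C with z in T by ring.
    replace (Cmod (z - w)) with (Cmod (w - z)) in T by (rewrite <- Cmod_opp; f_equal; ring). lra. }
  assert (Hw0 : w <> 0%C) by (apply Cmod_gt_0; lra).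
  replace (/ w - / z - (w - z) * - / (z * z))%C with ((w - z) * ((w - z) / (w * z * z)))%C
    by (field; auto).
  rewrite Cmod_mult, Cmod_div by (repeat apply Cmult_neq_0; auto).
  rewrite !Cmod_mult, Rmult_comm. apply Rmult_le_compat_r; [apply Cmod_ge_0|].
  apply Rle_div_l; [repeat apply Rmult_lt_0_compat; lra|].
  assert (eps * Cmod z ^ 3 / 2 <= eps * (Cmod w * Cmod z * Cmod z)); [|lra].
  replace (eps * Cmod z ^ 3 / 2) with (eps * (Cmod z / 2 * Cmod z * Cmod z)) by (simpl; field).
  apply Rmult_le_compat_l; [lra|]. repeat apply Rmult_le_compat_r; lra.
Qed.
Lemma holo_inv (F : C -> C) (z : C) : F z <> 0%C -> holo_at F z -> holo_at (fun w => (/ F w)%C) z.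
Proof.
  intros Hz [l Hl]. eexists.
  apply (is_derive_comp (K := C_AbsRing) (V := AbsRing_NormedModule C_AbsRing) Cinv F z (- / (F z * F z))%C l).
  - apply is_derive_Cinv, Hz.
  - exact Hl.
Qed.

Lemma im_le_Cmod (c : C) : Rabs (Im c) <= Cmod c.
Proof. eapply Rle_trans; [apply Rmax_r|apply Rmax_Cmod]. Qed.

Lemma holo_cauchy_riemann (G : C -> C) (x y : R) :
  holo_at G (x, y) ->
  exists a b : R,
    differentiable_pt_lim (fun s t => Re (G (s, t))) x y a (- b) /\
    differentiable_pt_lim (fun s t => Im (G (s, t))) x y b a.
Proof.
  intros [l Hl]. exists (Re l), (Im l).
  rewrite is_derive_C_epsilon in Hl.
  assert (H : forall eps : posreal, locally_2d (fun u v =>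
     Cmod (G (u, v) - G (x, y) - ((u, v) - (x, y)) * l) <= eps * Rmax (Rabs (u - x)) (Rabs (v - y))) x y).
  { intros eps.
    assert (He : 0 < eps / 2) by (generalize (cond_pos eps); lra).
    destruct (Hl (mkposreal _ He)) as [d Hd].
    assert (Hd2 : 0 < d / 2) by (generalize (cond_pos d); lra).
    exists (mkposreal _ Hd2). intros u v Hu Hv. cbn [pos] in *.
    assert (B : Cmod ((u, v) - (x, y)) <= 2 * Rmax (Rabs (u - x)) (Rabs (v - y))).
    { eapply Rle_trans; [apply Cmod_2Rmax|].
      change (fst ((u, v) - (x, y))%C) with (u - x). change (snd ((u, v) - (x, y))%C) with (v - y).
      apply Rmult_le_compat_r; [apply Rle_trans with (Rabs (u - x)); [apply Rabs_pos|apply Rmax_l]|].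
      apply Rle_trans with (sqrt (2 * 2)); [apply sqrt_le_1_alt; lra|rewrite sqrt_square; lra]. }
    assert (Rmax (Rabs (u - x)) (Rabs (v - y)) < d / 2) by (apply Rmax_lub_lt; assumption).
    eapply Rle_trans; [apply Hd; lra|]. nra. }
  split; intros eps; destruct (H eps) as [d Hd]; exists d; intros u v Hu Hv;
    (eapply Rle_trans; [|apply (Hd u v Hu Hv)]).
  - eapply Rle_trans; [|apply re_le_Cmod]. right. f_equal.
    destruct (G (u, v)), (G (x, y)), l; simpl; ring.
  - eapply Rle_trans; [|apply im_le_Cmod]. right. f_equal.
    destruct (G (u, v)), (G (x, y)), l; simpl; ring.
Qed.

Definition circle_point (z0 : C) (r t : R) : C := (fst z0 + r * cos t, snd z0 + r * sin t).

Lemma circle_point_dist z0 r t : 0 <= r -> Cmod (circle_point z0 r t - z0) = r.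
Proof.
  intros Hr. unfold Cmod, circle_point; simpl.
  replace (_ + _) with (r * r).
  - apply sqrt_square, Hr.
  - generalize (sin2_cos2 t). unfold Rsqr. intros E.
    transitivity (r * r * (sin t * sin t + cos t * cos t)); [rewrite E; ring|ring].
Qed.

(** Serves to differentiate polar coordinates, where [f = exp] and [g] is
    [cos] or [sin]. *)
Lemma differentiable_mult2 (f g : R -> R) (c s t f' g' : R) :
  derivable_pt_lim f s f' -> derivable_pt_lim g t g' ->
  differentiable_pt_lim (fun u v => c + f u * g v) s t (f' * g t) (f s * g').
Proof.
  intros Hf Hg.
  assert (D : differentiable_pt_lim (fun a b => c + a * b) (f s) (g t) (g t) (f s)).
  { intros eps. exists eps. intros u v Hu Hv.
    replace (_ - _ - _) with ((u - f s) * (v - g t)) by ring.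
    rewrite Rabs_mult.
    apply Rmult_le_compat; try apply Rabs_pos; [lra|apply Rmax_r]. }
  assert (Df : differentiable_pt_lim (fun u _ => f u) s t f' 0)
    by (apply differentiable_pt_lim_proj1_0; exact Hf).
  assert (Dg : differentiable_pt_lim (fun _ v => g v) s t 0 g').
  { intros eps. destruct (differentiable_pt_lim_proj1_0 g t s g' Hg eps) as [d Hd].
    exists d. intros u v Hu Hv. specialize (Hd v u Hv Hu).
    rewrite Rmax_comm. replace (0 * (u - s) + g' * (v - t)) with (g' * (v - t) + 0 * (u - s)) by ring.
    exact Hd. }
  assert (H := differentiable_pt_lim_comp _ _ _ s t _ _ _ _ _ _ D Df Dg).
  replace (f' * g t) with (g t * f' + f s * 0) by ring.
  replace (f s * g') with (g t * 0 + f s * g') by ring. exact H.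
Qed.

(** In the coordinates [(s, t)] of [z0 + exp (s + i t)] the form
    [- Re G ds + Im G dt] is closed by the Cauchy-Riemann equations, and the
    two sides [t = 0] and [t = 2 pi] of the rectangle cancel by periodicity. *)
Lemma circle_integral_const (G : C -> C) (z0 : C) (r1 r2 : R) :
  0 < r1 <= r2 ->
  (forall z, Cmod (z - z0) <= r2 -> holo_at G z) ->
  RInt (fun t => Im (G (circle_point z0 r1 t))) 0 (2 * PI) =
  RInt (fun t => Im (G (circle_point z0 r2 t))) 0 (2 * PI).
Proof.
  intros [H1 H2] HG.
  pose (P := fun s t => - Re (G (circle_point z0 (exp s) t))).
  pose (Q := fun s t => Im (G (circle_point z0 (exp s) t))).
  assert (HL : ln r1 <= ln r2) by (apply ln_le; lra).
  assert (HC : closed_form_on P Q (ln r1) 0 (ln r2 - ln r1) (2 * PI)).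
  { intros s t Hs _.
    assert (Hr : exp s <= r2).
    { rewrite <- (exp_ln r2) by lra.
      destruct (Rle_lt_or_eq_dec s (ln r2)) as [L|E]; [lra|left; apply exp_increasing, L|rewrite E; lra]. }
    destruct (holo_cauchy_riemann G (fst z0 + exp s * cos t) (snd z0 + exp s * sin t)) as (a & b & DU & DV).
    { apply HG. fold (circle_point z0 (exp s) t). rewrite circle_point_dist by (left; apply exp_pos). exact Hr. }
    assert (DX := differentiable_mult2 exp cos (fst z0) s t _ _ (derivable_pt_lim_exp s) (derivable_pt_lim_cos t)).
    assert (DY := differentiable_mult2 exp sin (snd z0) s t _ _ (derivable_pt_lim_exp s) (derivable_pt_lim_sin t)).
    assert (CU := differentiable_pt_lim_comp _ _ _ s t _ _ _ _ _ _ DU DX DY).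
    assert (CV := differentiable_pt_lim_comp _ _ _ s t _ _ _ _ _ _ DV DX DY).
    cbv beta in CU, CV.
    eexists (- (a * (exp s * cos t) + - b * (exp s * sin t))), (b * (exp s * cos t) + a * (exp s * sin t)), _. split; [|exact CV].
    intros eps. destruct (CU eps) as [d Hd]. exists d. intros u v Hu Hv.
    specialize (Hd u v Hu Hv). unfold P, circle_point. rewrite <- Rabs_Ropp.
    eapply Rle_trans; [|exact Hd]. right. f_equal. ring. }
  assert (Z := goursat P Q (ln r1) 0 (ln r2 - ln r1) (2 * PI) ltac:(lra) ltac:(generalize PI_RGT_0; lra) HC).
  unfold circulation in Z.
  replace (ln r1 + (ln r2 - ln r1)) with (ln r2) in Z by ring. rewrite Rplus_0_l in Z.
  assert (EP : forall s, P s (2 * PI) = P s 0).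
  { intros s. unfold P, circle_point. rewrite cos_2PI, sin_2PI, cos_0, sin_0. reflexivity. }
  rewrite (RInt_ext (fun s => P s (2 * PI)) (fun s => P s 0)) in Z by (intros; apply EP).
  unfold Q in Z. rewrite !exp_ln in Z by lra. lra.
Qed.

(** * Minimum and Phragmen-Lindelof principles in the upper half plane *)

Ltac holo_tac :=
  match goal with
  | |- holo_at (fun w => (@?F w + @?G w)%C) ?z => apply (holo_plus F G z); holo_tac
  | |- holo_at (fun w => (@?F w * @?G w)%C) ?z => apply (holo_mult F G z); holo_tac
  | |- holo_at (fun w => w) ?z => apply (holo_id z)
  | |- holo_at (fun _ => ?c) ?z => apply (holo_const c z)
  | _ => idtac
  end.

Lemma holo_continuity_2d_Im (G : C -> C) (x y : R) :
  holo_at G (x, y) -> continuity_2d_pt (fun s t => Im (G (s, t))) x y.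
Proof.
  intros H. destruct (holo_cauchy_riemann G x y H) as (a & b & _ & D).
  apply differentiable_continuity_pt. exists b, a. exact D.
Qed.

Lemma circle_ex_RInt (G : C -> C) (z0 : C) (r : R) :
  0 <= r -> (forall z, Cmod (z - z0) <= r -> holo_at G z) ->
  ex_RInt (fun t => Im (G (circle_point z0 r t))) 0 (2 * PI).
Proof.
  intros Hr HG. apply (ex_RInt_continuous (V := R_CompleteNormedModule)). intros t _.
  apply continuity_pt_filterlim.
  assert (HH : holo_at G (circle_point z0 r t)) by (apply HG; rewrite circle_point_dist; lra).
  destruct (holo_cauchy_riemann G _ _ HH) as (a & b & _ & D).
  assert (DX : derivable_pt_lim (fun t => fst z0 + r * cos t) t (r * - sin t)).
  { apply is_derive_Reals. auto_derive; [exact I|ring]. }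
  assert (DY : derivable_pt_lim (fun t => snd z0 + r * sin t) t (r * cos t)).
  { apply is_derive_Reals. auto_derive; [exact I|ring]. }
  assert (DC := derivable_pt_lim_comp_2d _ _ _ t _ _ _ _ D DX DY).
  apply derivable_continuous_pt. eexists. exact DC.
Qed.

Lemma integral_square_circle (c y0 r d : R) :
  is_RInt (fun t => c + d * (2 * y0 * (r * sin t) + (r * sin t) ^ 2)) 0 (2 * PI)
    (2 * PI * c + d * (PI * r ^ 2)).
Proof.
  evar_last.
  - apply (is_RInt_derive (V := R_CompleteNormedModule)
      (fun t => c * t + d * (- 2 * y0 * r * cos t + r ^ 2 * (t / 2 - sin t * cos t / 2)))).
    + intros t _. auto_derive; [exact I|].
      assert (E := sin2_cos2 t). unfold Rsqr in E.
      replace (cos t * cos t) with (1 - sin t * sin t) by lra.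
      replace (sin t * sin t) with ((sin t) ^ 2) by ring. field_simplify.
      replace (cos t ^ 2) with (1 - sin t ^ 2) by (simpl; lra). field.
    + intros t _. apply continuity_pt_filterlim. apply derivable_continuous_pt.
      eexists. apply is_derive_Reals. auto_derive; [exact I|reflexivity].
  - unfold minus, plus, opp; simpl. rewrite cos_2PI, sin_2PI, cos_0, sin_0. field.
Qed.

(** Over a circle of radius [r], the mean of [Im G] is its value at the centre,
    while the mean of [y ^ 2] exceeds its central value by [r ^ 2 / 2]. *)
Lemma no_interior_minimum (G : C -> C) (z0 : C) (r d : R) :
  0 < r -> 0 < d -> (forall z, Cmod (z - z0) <= r -> holo_at G z) ->
  ~ (forall z, Cmod (z - z0) <= r -> Im (G z0) - d * Im z0 ^ 2 <= Im (G z) - d * Im z ^ 2).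
Proof.
  intros Hr Hd HG Hmin.
  assert (HPI := PI_RGT_0).
  assert (L : 2 * PI * Im (G z0) + d * (PI * r ^ 2) <= RInt (fun t => Im (G (circle_point z0 r t))) 0 (2 * PI)).
  { rewrite <- (is_RInt_unique _ _ _ _ (integral_square_circle (Im (G z0)) (Im z0) r d)).
    apply RInt_le; [lra| |apply circle_ex_RInt; [lra|exact HG]|].
    - eexists. apply integral_square_circle.
    - intros t _. assert (M := Hmin (circle_point z0 r t)).
      rewrite circle_point_dist in M by lra. specialize (M (Rle_refl r)).
      change (Im (circle_point z0 r t)) with (Im z0 + r * sin t) in M. nra. }
  (* A circle of radius [r'] so small that [Im G] varies by less than
     [d r^2 / 4] on it contradicts the mean over the circle of radius [r]. *)
  assert (He : 0 < d * r ^ 2 / 4).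
  { assert (0 < r ^ 2) by (apply pow_lt, Hr). assert (0 < d * r ^ 2) by (apply Rmult_lt_0_compat; auto). lra. }
  assert (H0 : holo_at G (fst z0, snd z0)).
  { rewrite <- surjective_pairing. apply HG. replace (z0 - z0)%C with (RtoC 0) by ring. rewrite Cmod_0. lra. }
  destruct (holo_continuity_2d_Im G _ _ H0 (mkposreal _ He)) as [e He2]. cbn [pos] in He2.
  assert (Hr' : 0 < Rmin r (e / 2)) by (apply Rmin_pos; [lra|generalize (cond_pos e); lra]).
  assert (Hr1 := Rmin_l r (e / 2)). assert (Hr2 := Rmin_r r (e / 2)).
  set (r' := Rmin r (e / 2)) in *.
  assert (U : RInt (fun t => Im (G (circle_point z0 r' t))) 0 (2 * PI)
     <= RInt (fun _ => Im (G z0) + d * r ^ 2 / 4) 0 (2 * PI)).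
  { apply RInt_le; [lra| |apply ex_RInt_const|].
    - apply circle_ex_RInt; [lra|]. intros z Hz. apply HG. lra.
    - intros t _.
      assert (A1 := COS_bound t). assert (A2 := SIN_bound t).
      assert (B : Rabs (Im (G (circle_point z0 r' t)) - Im (G z0)) < d * r ^ 2 / 4).
      { rewrite (surjective_pairing z0) at 2. apply He2.
        - replace (fst z0 + r' * cos t - fst z0) with (r' * cos t) by ring.
          apply Rabs_def1; nra.
        - replace (snd z0 + r' * sin t - snd z0) with (r' * sin t) by ring.
          apply Rabs_def1; nra. }
      apply Rabs_def2 in B. lra. }
  rewrite RInt_const in U. unfold scal in U; simpl in U. unfold mult in U; simpl in U.
  rewrite (circle_integral_const G z0 r' r) in U by (auto; lra).
  assert (0 < PI * (d * r ^ 2 / 4)) by (apply Rmult_lt_0_compat; lra).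
  simpl in *. nra.
Qed.

(** The term [- d * y ^ 2] makes the function strictly superharmonic, which
    excludes interior minima without a discussion of constant functions. *)
Lemma rectangle_minimum_principle (G : C -> C) (x1 x2 y1 y2 d : R) :
  x1 <= x2 -> y1 <= y2 -> 0 < d ->
  (forall x y, x1 <= x <= x2 -> y1 <= y <= y2 -> holo_at G (x, y)) ->
  (forall x y, x1 <= x <= x2 -> y1 <= y <= y2 ->
     (x = x1 \/ x = x2 \/ y = y1 \/ y = y2) -> 0 <= Im (G (x, y)) - d * y ^ 2) ->
  forall x y, x1 <= x <= x2 -> y1 <= y <= y2 -> 0 <= Im (G (x, y)) - d * y ^ 2.
Proof.
  intros Hx Hy Hd HG Hbd.
  destruct (rectangle_minimum (fun x y => Im (G (x, y)) - d * y ^ 2) x1 y1 (x2 - x1) (y2 - y1))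
    as (l & m & Hl & Hm & Hmin); [lra|lra| |].
  { intros s t Hs Ht. apply continuity_2d_pt_minus.
    - apply holo_continuity_2d_Im, HG; lra.
    - apply (continuity_1d_2d_pt_comp (fun y => d * y ^ 2) (fun _ y => y)); [|apply continuity_2d_pt_id2].
      apply derivable_continuous_pt. eexists. apply is_derive_Reals. auto_derive; [exact I|reflexivity]. }
  assert (Hlm : 0 <= Im (G (l, m)) - d * m ^ 2).
  { apply Rnot_lt_le. intros Hneg.
    assert (Hl1 : x1 < l < x2 /\ y1 < m < y2).
    { apply NNPP. intros HN. apply (Rlt_not_le _ _ Hneg). apply Hbd; lra. }
    pose (r := Rmin (Rmin (l - x1) (x2 - l)) (Rmin (m - y1) (y2 - m))).
    assert (Hr : 0 < r) by (repeat apply Rmin_pos; lra).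
    assert (R1 : r <= l - x1 /\ r <= x2 - l).
    { split; (eapply Rle_trans; [apply Rmin_l|]); [apply Rmin_l|apply Rmin_r]. }
    assert (R2 : r <= m - y1 /\ r <= y2 - m).
    { split; (eapply Rle_trans; [apply Rmin_r|]); [apply Rmin_l|apply Rmin_r]. }
    assert (Hin : forall z : C, Cmod (z - (l, m)) <= r -> x1 <= fst z <= x2 /\ y1 <= snd z <= y2).
    { intros z Hz. assert (A := re_le_Cmod (z - (l, m))). assert (B := im_le_Cmod (z - (l, m))).
      change (Re (z - (l, m))) with (fst z - l) in A. change (Im (z - (l, m))) with (snd z - m) in B.
      apply Rabs_le_between in A, B. lra. }
    apply (no_interior_minimum G (l, m) r d Hr Hd).
    - intros z Hz. rewrite (surjective_pairing z). apply HG; apply Hin, Hz.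
    - intros z Hz. assert (K := Hin z Hz). rewrite (surjective_pairing z).
      apply (Hmin (fst z) (snd z)); lra. }
  intros x y Hx' Hy'. eapply Rle_trans; [exact Hlm|]. apply Hmin; lra.
Qed.

Definition holo_upper (G : C -> C) : Prop := forall z, upper z -> holo_at G z.

(** The one-variable counterpart of nontangential validity at infinity: the
    threshold may depend on the aperture [c] of the cone. *)
Definition eventually_nt (P : C -> Prop) : Prop :=
  forall c, exists M, forall z, upper z -> Cmod z <= c * Im z -> M < Cmod z -> P z.

(** On the box [[-R0, R0] x [y1, R0]], the function
    [Im G + (e / R0) (x^2 - 2 y^2 + 3 R0 y) + K y1] is nonnegative on all four
    sides: near the real axis by the bound [- K y], on the far sides because
    [Im G >= - e R0] there (by the asymptotics inside a wide cone, by the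
    bound [- K y] below it) while the quadratic term is at least [e R0].  It is
    strictly superharmonic, hence nonnegative inside.  At a fixed point the
    added terms are at most [5 e y] when [R0] is large and [y1] small. *)
Lemma phragmen_lindelof (G : C -> C) (K : R) :
  holo_upper G ->
  (forall z, upper z -> - (K * Im z) <= Im (G z)) ->
  (forall e, 0 < e -> eventually_nt (fun z => - (e * Cmod z) <= Im (G z))) ->
  forall z, upper z -> 0 <= Im (G z).
Proof.
  intros HG HK Hnt [x y] Hy. unfold upper in Hy. simpl in Hy.
  assert (HK0 : exists K', 0 < K' /\ forall z, upper z -> - (K' * Im z) <= Im (G z)).
  { exists (Rabs K + 1). split; [generalize (Rabs_pos K); lra|].
    intros z Hz. specialize (HK z Hz). unfold upper in Hz.
    assert (Q := Rle_abs K). nra. }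
  clear HK K. destruct HK0 as (K & HKpos & HK).
  assert (main : forall e, 0 < e -> - (5 * e * y) <= Im (G (x, y))).
  { intros e He.
    (* Below the height [dl * R0] the bound [- K y] is already at least
       [- e R0]; above it, the box lies in the cone of aperture [2 / dl]. *)
    pose (dl := Rmin 1 (e / K)).
    assert (Hdl : 0 < dl) by (apply Rmin_pos; [lra|apply Rdiv_lt_0_compat; lra]).
    assert (Hdl1 : dl <= 1) by apply Rmin_l.
    assert (Hdl2 : K * dl <= e).
    { assert (B := Rmin_r 1 (e / K)). fold dl in B. apply Rmult_le_compat_l with (r := K) in B; [|lra].
      replace (K * (e / K)) with e in B by (field; lra). lra. }
    destruct (Hnt (e / 2) ltac:(lra) (2 / dl)) as [M HM].
    pose (R0 := Rabs M + Rabs x + y + x ^ 2 / y + 1).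
    assert (P1 := Rle_abs M). assert (P2 := Rabs_pos M). assert (P3 := Rabs_pos x).
    assert (P4 : 0 <= x ^ 2 / y) by (apply Rdiv_le_0_compat; [apply pow2_ge_0|lra]).
    assert (HR : 0 < R0) by (unfold R0; lra).
    assert (HRx : Rabs x <= R0) by (unfold R0; lra). apply Rabs_le_between in HRx.
    assert (HRM : M < R0) by (unfold R0; lra).
    assert (HRy : y <= R0) by (unfold R0; lra).
    assert (HR2 : x ^ 2 / R0 <= y).
    { apply Rle_div_l; [lra|]. assert (A : x ^ 2 / y <= R0) by (unfold R0; lra).
      apply Rle_div_l in A; lra. }
    assert (far : forall s t, - R0 <= s <= R0 -> 0 < t <= R0 -> (R0 <= Rabs s \/ R0 <= t) ->
      - (e * R0) <= Im (G (s, t))).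
    { intros s t Hs Ht Hfar.
      destruct (Rle_lt_dec (dl * R0) t) as [Hcone|Hlow].
      - assert (Hge : R0 <= Cmod (s, t)).
        { destruct Hfar as [Hf|Hf].
          - eapply Rle_trans; [exact Hf|apply (re_le_Cmod (s, t))].
          - eapply Rle_trans; [exact Hf|]. eapply Rle_trans; [apply Rle_abs|apply (im_le_Cmod (s, t))]. }
        assert (Hle : Cmod (s, t) <= 2 * R0).
        { unfold Cmod; simpl. apply Rle_trans with (sqrt ((2 * R0) * (2 * R0))).
          - apply sqrt_le_1_alt. nra.
          - rewrite sqrt_square; lra. }
        assert (A : - (e / 2 * Cmod (s, t)) <= Im (G (s, t))).
        { apply HM.
          - exact (proj1 Ht).
          - simpl. eapply Rle_trans; [exact Hle|].
            replace (2 * R0) with (2 / dl * (dl * R0)) by (field; lra).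
            apply Rmult_le_compat_l; [left; apply Rdiv_lt_0_compat; lra|exact Hcone].
          - lra. }
        nra.
      - assert (A := HK (s, t) (proj1 Ht)). simpl in A. nra. }
    pose (y1 := Rmin y (e * y / K)).
    assert (Hy1 : 0 < y1).
    { apply Rmin_pos; [lra|]. apply Rdiv_lt_0_compat; [nra|lra]. }
    assert (Hy1y : y1 <= y) by apply Rmin_l.
    assert (Hb : K * y1 <= e * y).
    { assert (B := Rmin_r y (e * y / K)). fold y1 in B. apply Rmult_le_compat_l with (r := K) in B; [|lra].
      replace (K * (e * y / K)) with (e * y) in B by (field; lra). lra. }
    pose (d := e / R0).
    assert (Hd : 0 < d) by (apply Rdiv_lt_0_compat; lra).
    assert (HdR : d * R0 = e) by (unfold d; field; lra).
    (* [x^2 - y^2 + 3 R0 y] is the imaginary part of [i z^2 + 3 R0 z]; the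
       missing [- d y^2] is supplied by the minimum principle. *)
    pose (F := fun z : C => (G z + (RtoC d * (Ci * z * z + RtoC (3 * R0) * z) + Ci * RtoC (K * y1)))%C).
    assert (HF : forall s t, Im (F (s, t)) - d * t ^ 2 =
      Im (G (s, t)) + d * (s ^ 2 - 2 * t ^ 2 + 3 * R0 * t) + K * y1).
    { intros s t. unfold F. rewrite im_plus. simpl. ring. }
    assert (B : 0 <= Im (F (x, y)) - d * y ^ 2).
    { apply (rectangle_minimum_principle F (- R0) R0 y1 R0 d); try lra.
      - intros s t _ Ht. unfold F.
        holo_tac.
        apply HG. unfold upper; simpl; lra.
      - intros s t Hs Ht Hside. rewrite HF.
        assert (S0 : 0 <= s ^ 2) by apply pow2_ge_0.
        assert (Hside' : (R0 <= Rabs s \/ R0 <= t) \/ t = y1).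
        { destruct Hside as [E|[E|[E|E]]]; rewrite E; [left; left|left; left|right; reflexivity|left; right; lra].
          - rewrite Rabs_Ropp, Rabs_pos_eq; lra.
          - rewrite Rabs_pos_eq; lra. }
        destruct Hside' as [Hf|E].
        + assert (A := far s t Hs ltac:(lra) Hf).
          assert (R0 * R0 <= s ^ 2 - 2 * t ^ 2 + 3 * R0 * t).
          { destruct Hf as [Hf|Hf].
            - assert (R0 * R0 <= s ^ 2) by (rewrite <- Rsqr_pow2; rewrite Rsqr_abs; unfold Rsqr; nra). nra.
            - assert (t = R0) by lra. subst t. nra. }
          assert (d * (R0 * R0) <= d * (s ^ 2 - 2 * t ^ 2 + 3 * R0 * t)) by (apply Rmult_le_compat_l; lra).
          nra.
        + subst t. assert (A := HK (s, y1) Hy1). simpl in A.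
          assert (0 <= d * (s ^ 2 - 2 * y1 ^ 2 + 3 * R0 * y1)) by (apply Rmult_le_pos; nra). lra. }
    rewrite HF in B.
    assert (E1 : d * x ^ 2 <= e * y).
    { replace (d * x ^ 2) with (e * (x ^ 2 / R0)) by (unfold d; field; lra). apply Rmult_le_compat_l; lra. }
    assert (0 <= d * y ^ 2) by (apply Rmult_le_pos; [lra|apply pow2_ge_0]).
    replace (d * (x ^ 2 - 2 * y ^ 2 + 3 * R0 * y)) with (d * x ^ 2 - 2 * (d * y ^ 2) + 3 * (d * R0) * y) in B by ring.
    rewrite HdR in B. nra. }
  apply Rnot_lt_le. intros Hneg.
  assert (He : 0 < - Im (G (x, y)) / (10 * y)) by (apply Rdiv_lt_0_compat; lra).
  specialize (main _ He).
  replace (5 * (- Im (G (x, y)) / (10 * y)) * y) with (- Im (G (x, y)) / 2) in main by (field; lra). lra.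
Qed.

(** * One-variable functions with nonnegative imaginary part *)

Lemma eventually_nt_and (P Q : C -> Prop) :
  eventually_nt P -> eventually_nt Q -> eventually_nt (fun z => P z /\ Q z).
Proof.
  intros HP HQ c. destruct (HP c) as [M1 H1]. destruct (HQ c) as [M2 H2].
  exists (Rmax M1 M2). intros z Hz Hc HM.
  assert (A := Rmax_l M1 M2). assert (B := Rmax_r M1 M2).
  split; [apply H1|apply H2]; auto; lra.
Qed.

Lemma eventually_nt_impl (P Q : C -> Prop) :
  (forall z, upper z -> P z -> Q z) -> eventually_nt P -> eventually_nt Q.
Proof.
  intros H HP c. destruct (HP c) as [M HM]. exists M. auto.
Qed.

Lemma eventually_nt_far (M : R) : eventually_nt (fun z => M < Cmod z).
Proof. intros c. exists M. auto. Qed.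

Definition tends_nt (F : C -> C) (l : C) : Prop :=
  forall e, 0 < e -> eventually_nt (fun z => Cmod (F z - l) <= e).

Definition im_nonneg (f : C -> C) : Prop := forall z, upper z -> 0 <= Im (f z).

Lemma upper_neq_0 (z : C) : upper z -> z <> 0%C.
Proof. unfold upper. intros H ->. simpl in H. lra. Qed.

(** Along the ray through [x + i y], [Im f >= 0] says in the limit that
    [Im (rho / (x + i y)) >= 0]. *)
Lemma residue_half_plane (f : C -> C) (rho : C) (x y : R) :
  im_nonneg f -> tends_nt (fun z => (z * f z)%C) rho -> 0 < y ->
  0 <= x * Im rho - y * Re rho.
Proof.
  intros Hf Hlim Hy. apply Rnot_lt_le. intros Hneg.
  pose (zeta := (x, y) : C).
  assert (Hz : 0 < Cmod zeta) by (apply Cmod_gt_0, upper_neq_0; exact Hy).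
  pose (e := - (x * Im rho - y * Re rho) / (2 * Cmod zeta)).
  assert (He : 0 < e) by (apply Rdiv_lt_0_compat; lra).
  destruct (Hlim e He (Cmod zeta / y)) as [M HM].
  pose (s := (Rabs M + 1) / Cmod zeta).
  assert (HM0 := Rle_abs M). assert (HM1 := Rabs_pos M).
  assert (Hs : 0 < s) by (apply Rdiv_lt_0_compat; lra).
  assert (Hcs : Cmod (RtoC s * zeta) = Rabs M + 1).
  { rewrite Cmod_mult, Cmod_R, Rabs_pos_eq by lra. unfold s. field. lra. }
  assert (Hup : upper (RtoC s * zeta)).
  { unfold upper. rewrite im_scal_l. simpl. apply Rmult_lt_0_compat; lra. }
  assert (B := HM (RtoC s * zeta)%C Hup).
  specialize (Hf _ Hup).
  rewrite im_scal_l, Hcs in B. simpl Im in B.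
  assert (B' : Cmod (RtoC s * zeta * f (RtoC s * zeta)%C - rho) <= e).
  { apply B; [|lra]. right. unfold s. field. split; lra. }
  clear B. set (w := f (RtoC s * zeta)%C) in *.
  assert (I1 : Im ((RtoC s * zeta * w - rho) * Cconj zeta) <= e * Cmod zeta).
  { eapply Rle_trans; [apply Rle_abs|]. eapply Rle_trans; [apply im_le_Cmod|].
    rewrite Cmod_mult, Cmod_conj. apply Rmult_le_compat_r; lra. }
  assert (I2 : Im ((RtoC s * zeta * w - rho) * Cconj zeta)
      = s * (x ^ 2 + y ^ 2) * Im w - (y * - Re rho + x * Im rho)).
  { destruct w, rho. unfold zeta. simpl. ring. }
  assert (e * Cmod zeta = - (x * Im rho - y * Re rho) / 2) by (unfold e; field; lra).
  assert (0 <= s * (x ^ 2 + y ^ 2) * Im w).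
  { assert (0 <= x ^ 2) by apply pow2_ge_0. assert (0 <= y ^ 2) by apply pow2_ge_0.
    apply Rmult_le_pos; [apply Rmult_le_pos; lra|lra]. }
  lra.
Qed.

Lemma residue_nonpos (f : C -> C) (rho : C) :
  im_nonneg f -> tends_nt (fun z => (z * f z)%C) rho -> Re rho <= 0.
Proof.
  intros H1 H2. assert (A := residue_half_plane f rho 0 1 H1 H2 Rlt_0_1). lra.
Qed.

(** The inequality for the points [i y + 1] and [i y - 1], with [y] tending to
    0, bounds [Im rho] from both sides. *)
Lemma residue_real (f : C -> C) (rho : C) :
  im_nonneg f -> tends_nt (fun z => (z * f z)%C) rho -> Im rho = 0.
Proof.
  intros H1 H2. assert (N := residue_nonpos f rho H1 H2).
  apply cond_eq. intros e He. rewrite Rminus_0_r.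
  pose (y := e / (2 * (1 - Re rho))).
  assert (Hy : 0 < y) by (apply Rdiv_lt_0_compat; lra).
  assert (A := residue_half_plane f rho 1 y H1 H2 Hy).
  assert (B := residue_half_plane f rho (-1) y H1 H2 Hy).
  assert (E : y * (1 - Re rho) = e / 2) by (unfold y; field; lra).
  apply Rabs_def1; lra.
Qed.

Lemma Im_Cinv (c : C) : c <> 0%C -> Im (/ c) = - Im c / Cmod c ^ 2.
Proof. intros H. rewrite Cmod2_alt. reflexivity. Qed.

(** The function [- 1 / g + z / b] is [o(z)] in cones, and its imaginary part
    is at least [y / b] because [Im (- 1 / g) > 0].  By the Phragmen-Lindelof
    principle the imaginary part is nonnegative, which is the claim divided by
    [- b |g|^2]. *)
Lemma julia_strict (g : C -> C) (b : R) :
  holo_upper g -> (forall z, upper z -> 0 < Im (g z)) -> b < 0 ->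
  tends_nt (fun z => (z * g z)%C) b ->
  forall z, upper z -> Cmod (g z) ^ 2 * Im z <= - b * Im (g z).
Proof.
  intros Hg Hpos Hb Hlim.
  pose (G := fun z : C => (RtoC (- (1)) * / g z + RtoC (/ b) * z)%C).
  assert (Hg0 : forall z, upper z -> g z <> 0%C).
  { intros z Hz E. specialize (Hpos z Hz). rewrite E in Hpos. simpl in Hpos. lra. }
  assert (HIm : forall z, upper z -> Im (G z) = Im (g z) / Cmod (g z) ^ 2 + / b * Im z).
  { intros z Hz. unfold G. rewrite im_plus, !im_scal_l, Im_Cinv by auto. unfold Rdiv. ring. }
  assert (HM2 : forall z, upper z -> 0 < Cmod (g z) ^ 2).
  { intros z Hz. apply pow_lt, Cmod_gt_0, Hg0, Hz. }
  assert (Main : forall z, upper z -> 0 <= Im (G z)).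
  { apply (phragmen_lindelof G (- / b)).
    - intros z Hz. unfold G. holo_tac. apply holo_inv.
      + apply Hg0, Hz.
      + apply Hg, Hz.
    - intros z Hz. rewrite HIm by exact Hz.
      assert (0 <= Im (g z) / Cmod (g z) ^ 2) by (apply Rdiv_le_0_compat; [left; auto|auto]). lra.
    - intros e He.
      (* The first bound keeps [|z g|] above [|b| / 2]; the second then gives
         [|G z| <= e |z|]. *)
      pose (eta := Rmin (- b / 2) (e * b ^ 2 / 2)).
      assert (Hb2 : 0 < b ^ 2) by (simpl; nra).
      assert (Heta : 0 < eta) by (apply Rmin_pos; nra).
      apply (eventually_nt_impl (fun z => Cmod (z * g z - RtoC b) <= eta)); [|apply Hlim, Heta].
      intros z Hz A.
      assert (A1 := Rle_trans _ _ _ A (Rmin_l _ _)). assert (A2 := Rle_trans _ _ _ A (Rmin_r _ _)).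
      assert (Hzg : - b / 2 <= Cmod (z * g z)).
      { assert (T := Cmod_triangle (z * g z) (RtoC b - z * g z)).
        replace (z * g z + (RtoC b - z * g z))%C with (RtoC b) in T by ring.
        replace (Cmod (RtoC b - z * g z)) with (Cmod (z * g z - RtoC b)) in T
          by (rewrite <- Cmod_opp; f_equal; ring).
        rewrite Cmod_R, Rabs_left in T by lra. lra. }
      assert (Hz0 := upper_neq_0 z Hz). assert (Hgz := Hg0 z Hz).
      assert (Hb0 : RtoC b <> 0%C) by (intros E; apply RtoC_inj in E; lra).
      assert (EG : G z = ((z * g z - RtoC b) * z / (z * g z * RtoC b))%C).
      { unfold G. rewrite RtoC_inv, RtoC_opp by lra. field. auto. }
      assert (BG : Cmod (G z) <= e * Cmod z).
      { rewrite EG, Cmod_div by (repeat apply Cmult_neq_0; auto).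
        rewrite (Cmod_mult _ z), (Cmod_mult (z * g z)), (Cmod_R b), (Rabs_left b) by lra.
        apply Rle_div_l; [nra|].
        replace (e * Cmod z * (Cmod (z * g z) * - b)) with (e * (Cmod (z * g z) * - b) * Cmod z) by ring.
        apply Rmult_le_compat_r; [apply Cmod_ge_0|].
        eapply Rle_trans; [exact A2|].
        replace (e * b ^ 2 / 2) with (e * (- b / 2 * - b)) by (simpl; field).
        apply Rmult_le_compat_l; [lra|]. apply Rmult_le_compat_r; lra. }
      assert (D := im_le_Cmod (G z)). apply Rabs_le_between in D. lra. }
  intros z Hz. specialize (Main z Hz). rewrite HIm in Main by exact Hz.
  assert (HM := HM2 z Hz). assert (HM' : Cmod (g z) <> 0) by (intros E; rewrite E in HM; lra).
  assert (E : - b * Im (g z) - Cmod (g z) ^ 2 * Im z =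
    (- b * Cmod (g z) ^ 2) * (Im (g z) / Cmod (g z) ^ 2 + / b * Im z)) by (field; repeat split; (exact HM' || lra)).
  assert (0 <= (- b * Cmod (g z) ^ 2) * (Im (g z) / Cmod (g z) ^ 2 + / b * Im z)).
  { apply Rmult_le_pos; [|exact Main]. apply Rmult_le_pos; lra. }
  lra.
Qed.

(** The strict case applies to [f - e / z], which has the residue [a - e < 0]
    and a positive imaginary part; then [e] tends to 0. *)
Lemma julia (f : C -> C) (a : R) :
  holo_upper f -> im_nonneg f -> tends_nt (fun z => (z * f z)%C) a ->
  forall z, upper z -> Cmod (f z) ^ 2 * Im z <= - a * Im (f z).
Proof.
  intros Hf Hpos Hlim z Hz.
  assert (Ha : a <= 0) by exact (residue_nonpos f a Hpos Hlim).
  assert (Hz0 := upper_neq_0 z Hz).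
  assert (Hzm : 0 < Cmod z) by (apply Cmod_gt_0, Hz0).
  assert (main : forall e, 0 < e <= 1 -> Cmod (f z) ^ 2 * Im z <= - a * Im (f z)
     + e * (2 * Cmod (f z) / Cmod z * Im z + Im (f z) + (1 - a) * (Im z / Cmod z ^ 2))).
  { intros e He.
    pose (g := fun w : C => (f w + RtoC (- e) * / w)%C).
    assert (HIm : forall w, upper w -> Im (g w) = Im (f w) + e * (Im w / Cmod w ^ 2)).
    { intros w Hw. unfold g. rewrite im_plus, im_scal_l, Im_Cinv by (apply upper_neq_0, Hw).
      unfold Rdiv. ring. }
    assert (J := julia_strict g (a - e)).
    assert (J' : Cmod (g z) ^ 2 * Im z <= - (a - e) * Im (g z)).
    { apply J; auto; try lra.
      - intros w Hw. unfold g. holo_tac; [apply Hf, Hw|apply holo_inv; [apply upper_neq_0, Hw|apply holo_id]].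
      - intros w Hw. rewrite HIm by exact Hw. specialize (Hpos w Hw).
        assert (0 < Im w / Cmod w ^ 2).
        { apply Rdiv_lt_0_compat; [exact Hw|]. apply pow_lt, Cmod_gt_0, upper_neq_0, Hw. }
        assert (0 < e * (Im w / Cmod w ^ 2)) by (apply Rmult_lt_0_compat; lra). lra.
      - intros e' He'. apply (eventually_nt_impl (fun w => Cmod (w * f w - RtoC a) <= e')); [|apply Hlim, He'].
        intros w Hw B. assert (Hw0 := upper_neq_0 w Hw).
        replace (w * g w - RtoC (a - e))%C with (w * f w - RtoC a)%C; [exact B|].
        unfold g. rewrite RtoC_minus, RtoC_opp. field. exact Hw0. }
    rewrite HIm in J' by exact Hz.
    assert (T1 : Cmod (f z) <= Cmod (g z) + e / Cmod z).
    { assert (T := Cmod_triangle (g z) (RtoC e * / z)).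
      replace (g z + RtoC e * / z)%C with (f z) in T by (unfold g; rewrite RtoC_opp; ring).
      rewrite Cmod_mult, Cmod_R, Cmod_inv, Rabs_pos_eq in T by (auto; lra). exact T. }
    assert (T2 : e / Cmod z <= Cmod (f z) + Cmod (g z)).
    { assert (T := Cmod_triangle (f z) (- g z)). rewrite Cmod_opp in T.
      replace (f z + - g z)%C with (RtoC e * / z)%C in T by (unfold g; rewrite RtoC_opp; ring).
      rewrite Cmod_mult, Cmod_R, Cmod_inv, Rabs_pos_eq in T by (auto; lra). exact T. }
    unfold upper in Hz.
    assert (P1 := Cmod_ge_0 (f z)). assert (P2 := Cmod_ge_0 (g z)).
    (* [|g| >= | |f| - e / |z| |], squared. *)
    assert (S : Cmod (f z) ^ 2 - 2 * Cmod (f z) * (e / Cmod z) <= Cmod (g z) ^ 2) by nra.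
    apply Rmult_le_compat_r with (r := Im z) in S; [|lra].
    specialize (Hpos z Hz).
    assert (P3 : 0 <= Im z / Cmod z ^ 2) by (apply Rdiv_le_0_compat; [lra|apply pow_lt, Hzm]).
    replace (e * (2 * Cmod (f z) / Cmod z * Im z + Im (f z) + (1 - a) * (Im z / Cmod z ^ 2)))
      with (2 * Cmod (f z) * (e / Cmod z) * Im z + e * Im (f z) + (1 - a) * e * (Im z / Cmod z ^ 2))
      by (field; lra).
    set (q := Im z / Cmod z ^ 2) in *.
    assert (e * (e * q) <= e * q).
    { assert (0 <= e * q) by (apply Rmult_le_pos; lra). nra. }
    nra. }
  apply Rnot_lt_le. intros Hneg.
  set (S := 2 * Cmod (f z) / Cmod z * Im z + Im (f z) + (1 - a) * (Im z / Cmod z ^ 2)) in *.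
  set (D := Cmod (f z) ^ 2 * Im z - - a * Im (f z)).
  assert (HD : 0 < D) by (unfold D; lra).
  (* Small enough that the error term [e * S] is at most half the defect [D]. *)
  pose (e := Rmin 1 (D / (2 * (Rabs S + 1)))).
  assert (PS := Rabs_pos S). assert (PS' := Rle_abs S).
  assert (He : 0 < e) by (apply Rmin_pos; [lra|apply Rdiv_lt_0_compat; lra]).
  assert (He1 : e <= 1) by apply Rmin_l.
  assert (He2 : e * (Rabs S + 1) <= D / 2).
  { apply Rle_trans with (D / (2 * (Rabs S + 1)) * (Rabs S + 1)); [|right; field; lra].
    apply Rmult_le_compat_r; [lra|apply Rmin_r]. }
  specialize (main e (conj He He1)).
  unfold D in *. nra.
Qed.

(** If [f] is the Stieltjes transform of a measure [mu], so that [- a] and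
    [- b] are its first two moments, then this is the Stieltjes transform of
    [t^2 mu]. *)
Definition moment_shift (a b : R) (f : C -> C) (z : C) : C :=
  (z * z * f z + (RtoC (- a) * z + RtoC (- b)))%C.

Lemma holo_moment_shift a b f : holo_upper f -> holo_upper (moment_shift a b f).
Proof.
  intros Hf z Hz. unfold moment_shift. holo_tac. apply Hf, Hz.
Qed.

Lemma tends_nt_moment_shift a b f rho :
  tends_nt (fun z => (z * moment_shift a b f z)%C) rho -> tends_nt (fun z => (z * f z)%C) a.
Proof.
  intros H e He.
  pose (B := Cmod rho + 1 + Rabs b).
  assert (HB : 0 < B) by (unfold B; generalize (Cmod_ge_0 rho) (Rabs_pos b); lra).
  apply (eventually_nt_impl (fun z => Cmod (z * moment_shift a b f z - rho) <= 1 /\ Rmax 1 (B / e) < Cmod z)).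
  - intros z Hz [A1 A2].
    assert (Hz0 := upper_neq_0 z Hz).
    assert (M1 := Rle_lt_trans _ _ _ (Rmax_l _ _) A2). assert (M2 := Rle_lt_trans _ _ _ (Rmax_r _ _) A2).
    set (w := (z * moment_shift a b f z)%C) in *.
    assert (Hw : Cmod w <= Cmod rho + 1).
    { assert (T := Cmod_triangle (w - rho) rho). replace (w - rho + rho)%C with w in T by ring. lra. }
    replace (z * f z - RtoC a)%C with ((w / z + RtoC b) / z)%C.
    2: { unfold w, moment_shift. rewrite !RtoC_opp. field. exact Hz0. }
    rewrite Cmod_div by exact Hz0.
    apply Rle_div_l; [lra|].
    assert (Cmod (w / z + RtoC b) <= B).
    { eapply Rle_trans; [apply Cmod_triangle|]. rewrite Cmod_R, Cmod_div by exact Hz0.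
      unfold B. apply Rplus_le_compat_r. apply Rle_div_l; [lra|].
      assert (P := Cmod_ge_0 rho). nra. }
    apply Rlt_div_l in M2; lra.
  - apply eventually_nt_and; [apply H; lra|apply eventually_nt_far].
Qed.

(** With [U + i V = f], the Julia inequality [y (U^2 + V^2) <= - a V] gives
    [y^2 V <= - a y] and, after completing the square,
    [x^2 V + 2 x y U >= a y]; together these bound the imaginary part from
    below by a multiple of [- y]. *)
Lemma im_nonneg_moment_shift a b f rho :
  holo_upper f -> im_nonneg f -> tends_nt (fun z => (z * moment_shift a b f z)%C) rho ->
  im_nonneg (moment_shift a b f).
Proof.
  intros Hf Hpos Hlim.
  assert (Hfa := tends_nt_moment_shift a b f rho Hlim).
  assert (Ha : a <= 0) by exact (residue_nonpos f a Hpos Hfa).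
  assert (J := julia f a Hf Hpos Hfa).
  refine (phragmen_lindelof (moment_shift a b f) (- 2 * a) _ _ _); [apply holo_moment_shift, Hf| |].
  - intros z Hz. specialize (J z Hz). specialize (Hpos z Hz). unfold upper in Hz.
    rewrite Cmod2_alt in J.
    assert (E : Im (moment_shift a b f z) =
      (Re z ^ 2 - Im z ^ 2) * Im (f z) + 2 * Re z * Im z * Re (f z) - a * Im z).
    { unfold moment_shift. destruct z, (f (r, r0)). simpl. ring. }
    rewrite E. set (x := Re z) in *. set (y := Im z) in *.
    set (U := Re (f z)) in *. set (V := Im (f z)) in *. clearbody x y U V. clear E.
    assert (HVy : y * V <= - a).
    { destruct (Req_dec V 0) as [->|HV]; [lra|].
      assert (0 < V) by lra. apply Rmult_le_reg_r with V; [lra|].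
      assert (0 <= U ^ 2 * y) by (apply Rmult_le_pos; [apply pow2_ge_0|lra]). nra. }
    assert (H1 : y ^ 2 * V <= - a * y) by nra.
    assert (H2 : a * y <= x ^ 2 * V + 2 * x * y * U).
    { destruct (Req_dec a 0) as [Ea|Ea].
      - assert (HU : U = 0).
        { rewrite Ea in J. assert (0 <= V ^ 2) by apply pow2_ge_0.
          assert (0 <= U ^ 2) by apply pow2_ge_0.
          assert (U ^ 2 <= 0); [|nra].
          apply Rmult_le_reg_r with y; [lra|]. nra. }
        rewrite HU, Ea. assert (0 <= x ^ 2 * V) by (apply Rmult_le_pos; [apply pow2_ge_0|lra]). lra.
      - assert (Ha' : 0 < - a) by lra.
        apply Rmult_le_reg_l with (- a); [lra|].
        assert (K1 : x ^ 2 * (U ^ 2 * y) <= x ^ 2 * (- a * V)).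
        { apply Rmult_le_compat_l; [apply pow2_ge_0|].
          assert (0 <= V ^ 2 * y) by (apply Rmult_le_pos; [apply pow2_ge_0|lra]). lra. }
        assert (K2 : 0 <= y * (x * U - a) ^ 2) by (apply Rmult_le_pos; [lra|apply pow2_ge_0]).
        nra. }
    nra.
  - intros e He.
    pose (B := Cmod rho + 1).
    assert (HB : 0 < B) by (unfold B; generalize (Cmod_ge_0 rho); lra).
    apply (eventually_nt_impl (fun z => Cmod (z * moment_shift a b f z - rho) <= 1 /\ Rmax 1 (B / e) < Cmod z)).
    + intros z Hz [A1 A2].
      assert (Hz0 := upper_neq_0 z Hz).
      assert (M1 := Rle_lt_trans _ _ _ (Rmax_l _ _) A2). assert (M2 := Rle_lt_trans _ _ _ (Rmax_r _ _) A2).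
      set (w := moment_shift a b f z) in *.
      assert (Hw : Cmod z * Cmod w <= B).
      { rewrite <- Cmod_mult. assert (T := Cmod_triangle (z * w - rho) rho).
        replace (z * w - rho + rho)%C with (z * w)%C in T by ring. unfold B. lra. }
      apply Rlt_div_l in M2; [|lra].
      assert (D := im_le_Cmod w). apply Rabs_le_between in D.
      assert (P := Cmod_ge_0 w). nra.
    + apply eventually_nt_and; [apply Hlim; lra|apply eventually_nt_far].
Qed.

(** The remainder of [f] after the terms [r 0 / z, ..., r (2n-1) / z^(2n)],
    multiplied by [z^(2n)], written as iterated shifts so that induction
    on [n] applies. *)
Fixpoint hamburger_tail (n : nat) (r : nat -> R) (f : C -> C) : C -> C :=
  match n with
  | O => f
  | S n => hamburger_tail n (fun k => r (S (S k))) (moment_shift (r O) (r 1%nat) f)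
  end.

(** The asymptotics of the last shift determines those of all earlier ones,
    so each shift satisfies the hypotheses needed for the next. *)
Lemma hamburger_tail_tends n : forall r f rho,
  tends_nt (fun z => (z * hamburger_tail n r f z)%C) rho ->
  exists rho', tends_nt (fun z => (z * f z)%C) rho'.
Proof.
  induction n as [|n IH]; intros r f rho H; [exists rho; exact H|].
  destruct (IH _ _ _ H) as [rho' H']. exists (RtoC (r O)). eapply tends_nt_moment_shift, H'.
Qed.

Lemma hamburger_last_coefficient_real n : forall r f rho,
  holo_upper f -> im_nonneg f -> tends_nt (fun z => (z * hamburger_tail n r f z)%C) rho ->
  Im rho = 0.
Proof.
  induction n as [|n IH]; intros r f rho Hf Hpos H; [apply (residue_real f rho Hpos H)|].
  destruct (hamburger_tail_tends n _ _ _ H) as [rho' H'].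
  apply (IH _ _ _ (holo_moment_shift _ _ f Hf) (im_nonneg_moment_shift _ _ f rho' Hf Hpos H') H).
Qed.

(** * Slices of functions of two variables, and the theorem *)

(** Finite sums have the type of an abstract monoid; these tactics restore the
    type under which the ring and field structures of [C] are declared. *)
Ltac C_ring := match goal with |- @eq _ ?a ?b => change (@eq C a b); ring end.
Ltac C_field := match goal with |- @eq _ ?a ?b => change (@eq C a b); field end.

Lemma sum_n_C_S (a : nat -> C) (m : nat) : sum_n a (S m) = (sum_n a m + a (S m))%C.
Proof. exact (sum_Sn a m). Qed.

Lemma sum_n_C_recl (a : nat -> C) (m : nat) :
  sum_n a (S m) = (a O + sum_n (fun k => a (S k)) m)%C.
Proof.
  induction m as [|m IH].
  - rewrite sum_n_C_S, !sum_O. reflexivity.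
  - rewrite sum_n_C_S, IH, (sum_n_C_S (fun k => a (S k))). C_ring.
Qed.

Lemma sum_n_C_scal (c : C) (a : nat -> C) (m : nat) :
  sum_n (fun k => (c * a k)%C) m = (c * sum_n a m)%C.
Proof. exact (sum_n_mult_l (K := C_Ring) c a m). Qed.

Lemma sum_n_C_minus (a b : nat -> C) (m : nat) :
  sum_n (fun k => (a k - b k)%C) m = (sum_n a m - sum_n b m)%C.
Proof.
  induction m as [|m IH]; [rewrite !sum_O; reflexivity|].
  rewrite !sum_n_C_S, IH. C_ring.
Qed.

(** Powers are taken in [R]: only real arguments are used. *)
Definition C_poly (d : nat -> C) (m : nat) (t : R) : C := sum_n (fun k => (d k * RtoC (t ^ k))%C) m.

Lemma C_poly_S d m t : C_poly d (S m) t = (d O + RtoC t * C_poly (fun k => d (S k)) m t)%C.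
Proof.
  unfold C_poly. rewrite sum_n_C_recl, <- sum_n_C_scal. simpl pow. f_equal; [C_ring|].
  apply sum_n_ext. intros k. rewrite RtoC_mult. C_ring.
Qed.

Lemma C_poly_bounded d m : exists B, 0 <= B /\ forall t, 0 < t <= 1 -> Cmod (C_poly d m t) <= B.
Proof.
  revert d. induction m as [|m IH]; intros d.
  - exists (Cmod (d O)). split; [apply Cmod_ge_0|]. intros t _. unfold C_poly. rewrite sum_O. simpl.
    rewrite Cmult_1_r. lra.
  - destruct (IH (fun k => d (S k))) as (B & HB & H). exists (Cmod (d O) + B).
    split; [generalize (Cmod_ge_0 (d O)); lra|].
    intros t Ht. rewrite C_poly_S. eapply Rle_trans; [apply Cmod_triangle|].
    rewrite Cmod_mult, Cmod_R, Rabs_pos_eq by lra. specialize (H t Ht).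
    assert (P := Cmod_ge_0 (C_poly (fun k => d (S k)) m t)). nra.
Qed.

Lemma eq_0_of_small (c : C) (B t0 : R) :
  0 < t0 -> (forall t, 0 < t < t0 -> Cmod c <= B * t) -> c = 0%C.
Proof.
  intros Ht0 H. apply Cmod_eq_0.
  destruct (Rle_lt_or_eq_dec 0 (Cmod c) (Cmod_ge_0 c)) as [L|E]; [exfalso|auto].
  pose (t := Rmin (t0 / 2) (Cmod c / (2 * (Rabs B + 1)))).
  assert (P := Rabs_pos B). assert (Q := Rle_abs B).
  assert (Ht : 0 < t) by (apply Rmin_pos; [lra|apply Rdiv_lt_0_compat; lra]).
  assert (T1 : t <= t0 / 2) by apply Rmin_l.
  assert (T2 : t * (Rabs B + 1) <= Cmod c / 2).
  { apply Rle_trans with (Cmod c / (2 * (Rabs B + 1)) * (Rabs B + 1)); [|right; field; lra].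
    apply Rmult_le_compat_r; [lra|apply Rmin_r]. }
  specialize (H t ltac:(lra)). nra.
Qed.

(** The coefficients vanish successively: the constant one by letting [t] tend
    to 0, after which the inequality can be divided by [t]. *)
Lemma C_poly_small_zero (d : nat -> C) (m : nat) (K t0 : R) :
  0 < t0 <= 1 -> 0 <= K ->
  (forall t, 0 < t < t0 -> Cmod (C_poly d m t) <= K * t ^ S m) ->
  forall k, (k <= m)%nat -> d k = 0%C.
Proof.
  intros Ht0 HK. revert d. induction m as [|m IH]; intros d H k Hk.
  - replace k with O by lia. apply (eq_0_of_small _ K t0); [lra|]. intros t Ht.
    specialize (H t Ht). unfold C_poly in H. rewrite sum_O in H. simpl in H.
    rewrite Cmult_1_r in H. lra.
  - assert (E : d O = 0%C).
    { destruct (C_poly_bounded (fun k => d (S k)) m) as (B & HB & HBt).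
      apply (eq_0_of_small _ (K + B) t0); [lra|]. intros t Ht.
      specialize (H t Ht). specialize (HBt t ltac:(lra)). rewrite C_poly_S in H.
      set (q := C_poly (fun k => d (S k)) m t) in *.
      assert (T := Cmod_triangle (d O + RtoC t * q) (- (RtoC t * q))).
      replace (d O + RtoC t * q + - (RtoC t * q))%C with (d O) in T by C_ring.
      rewrite Cmod_opp, Cmod_mult, Cmod_R, Rabs_pos_eq in T by lra.
      assert (t ^ S (S m) <= t).
      { assert (0 < t ^ S m) by (apply pow_lt; lra).
        assert (t ^ S m <= 1) by (rewrite <- (pow1 (S m)); apply pow_incr; lra).
        simpl pow in *. nra. }
      nra. }
    destruct k as [|k]; [exact E|].
    apply (IH (fun k => d (S k))); [|lia].
    intros t Ht. specialize (H t Ht). rewrite C_poly_S, E, Cplus_0_l, Cmod_mult, Cmod_R, Rabs_pos_eq in H by lra.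
    apply Rmult_le_reg_l with t; [lra|]. simpl pow in *. lra.
Qed.

Lemma hamburger_tail_formula n : forall (r : nat -> R) (f : C -> C) (z : C), z <> 0%C ->
  hamburger_tail n (fun k => r (S k)) f z =
  (z ^ (2 * n) * (f z + RtoC (r O) - sum_n (fun k => (RtoC (r k) / z ^ k)%C) (2 * n)))%C.
Proof.
  induction n as [|n IH]; intros r f z Hz.
  - simpl. rewrite sum_O. simpl. field.
  - simpl hamburger_tail. rewrite (IH (fun k => r (S (S k)))) by exact Hz.
    replace (2 * S n)%nat with (S (S (2 * n))) by lia.
    rewrite (sum_n_C_recl (fun k => (RtoC (r k) / z ^ k)%C)), (sum_n_C_recl (fun k => (RtoC (r (S k)) / z ^ S k)%C)).
    rewrite (sum_n_ext (fun k => (RtoC (r (S (S k))) / z ^ S (S k))%C)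
       (fun k => (/ (z * z) * (RtoC (r (S (S k))) / z ^ k))%C)).
    2: { intros k. simpl. field. repeat split; auto. apply Cpow_nz, Hz. }
    rewrite sum_n_C_scal. unfold moment_shift. rewrite !RtoC_opp. simpl Cpow.
    field. repeat split; auto.
Qed.

Lemma norm2_bounds (z : C2) :
  Cmod (fst z) <= norm2 z /\ Cmod (snd z) <= norm2 z /\ norm2 z <= Cmod (fst z) + Cmod (snd z).
Proof.
  change (norm2 z) with (sqrt (Cmod (fst z) ^ 2 + Cmod (snd z) ^ 2)).
  assert (A := Cmod_ge_0 (fst z)). assert (B := Cmod_ge_0 (snd z)).
  set (a := Cmod (fst z)) in *. set (b := Cmod (snd z)) in *.
  assert (0 <= a ^ 2) by apply pow2_ge_0. assert (0 <= b ^ 2) by apply pow2_ge_0.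
  repeat split.
  - rewrite <- (sqrt_pow2 a) at 1 by exact A. apply sqrt_le_1_alt. lra.
  - rewrite <- (sqrt_pow2 b) at 1 by exact B. apply sqrt_le_1_alt. lra.
  - rewrite <- (sqrt_pow2 (a + b)) by lra. apply sqrt_le_1_alt. nra.
Qed.

Definition slice (t : R) (z : C) : C2 := ((RtoC (/ t) * z)%C, z).

Lemma upper2_slice (t : R) (z : C) : 0 < t -> upper z -> upper2 (slice t z).
Proof.
  intros Ht Hz. split; [|exact Hz]. unfold upper in *. simpl fst. rewrite im_scal_l.
  apply Rmult_lt_0_compat; [apply Rinv_0_lt_compat, Ht|exact Hz].
Qed.

(** The aperture changes by a factor that depends only on [t], since both
    coordinates of [slice t z] are fixed multiples of [z]. *)
Lemma nontangential_slice (t c : R) (P : C2 -> Prop) : 0 < t ->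
  nontangential (Rabs c * (/ t + 1) * (1 + t)) P ->
  exists M, forall z, upper z -> Cmod z <= c * Im z -> M < Cmod z -> P (slice t z).
Proof.
  intros Ht [M HM].
  exists M. intros z Hz Hc Hbig.
  assert (Hi : 0 < / t) by (apply Rinv_0_lt_compat, Ht).
  destruct (norm2_bounds (slice t z)) as (_ & B2 & B3). simpl fst in B3. simpl snd in B2, B3.
  apply HM; [lra|]. split; [apply upper2_slice; assumption|].
  simpl fst; simpl snd. rewrite im_scal_l. rewrite Cmod_mult, Cmod_R, Rabs_pos_eq in B3 by lra.
  unfold upper in Hz.
  assert (HA : Cmod z <= Rabs c * Im z) by (assert (Q := Rle_abs c); nra).
  assert (Hmin : Im z <= (1 + t) * Rmin (/ t * Im z) (Im z)).
  { unfold Rmin. destruct (Rle_dec (/ t * Im z) (Im z)).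
    - replace ((1 + t) * (/ t * Im z)) with (/ t * Im z + Im z) by (field; lra). nra.
    - nra. }
  apply Rle_trans with ((/ t + 1) * (Rabs c * Im z)); [nra|].
  replace (Rabs c * (/ t + 1) * (1 + t) * Rmin (/ t * Im z) (Im z))
    with ((/ t + 1) * (Rabs c * ((1 + t) * Rmin (/ t * Im z) (Im z)))) by ring.
  apply Rmult_le_compat_l; [lra|]. apply Rmult_le_compat_l; [apply Rabs_pos|exact Hmin].
Qed.

(** The Frechet derivative of [h], applied to the direction of the line. *)
Lemma holo_slice (h : C2 -> C) t : 0 < t -> Pick2 h -> holo_upper (fun z => h (slice t z)).
Proof.
  intros Ht Hh z Hz.
  destruct (Hh (slice t z) (upper2_slice t z Ht Hz)) as [_ [l [Hlin Hl]]].
  specialize (Hl (slice t z) (fun P HP => HP)).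
  exists (l (slice t (RtoC 1))). apply is_derive_C_epsilon. intros eps.
  assert (Hi : 0 < / t) by (apply Rinv_0_lt_compat, Ht).
  assert (Hslice : forall w : C, norm2 (slice t w) <= (/ t + 1) * Cmod w).
  { intros w. destruct (norm2_bounds (slice t w)) as (_ & _ & B). simpl in B.
    rewrite Cmod_mult, Cmod_R, Rabs_pos_eq in B by lra. lra. }
  assert (Heps := cond_pos eps).
  assert (He : 0 < eps / (/ t + 1)) by (apply Rdiv_lt_0_compat; lra).
  specialize (Hl (mkposreal _ He)).
  apply (locally_norm_le_locally (V := C2)) in Hl. destruct Hl as [d Hd].
  assert (Hdp := cond_pos d).
  assert (Hdd : 0 < d / (/ t + 1)) by (apply Rdiv_lt_0_compat; lra).
  exists (mkposreal _ Hdd). intros w Hw. cbn [pos] in Hw.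
  assert (E : minus (G := C2) (slice t w) (slice t z) = slice t (w - z)%C).
  { unfold slice. apply injective_projections; [|reflexivity].
    change (fst (minus (G := C2) ((RtoC (/ t) * w)%C, w) ((RtoC (/ t) * z)%C, z)))
      with (RtoC (/ t) * w - RtoC (/ t) * z)%C. simpl fst. C_ring. }
  specialize (Hd (slice t w)). unfold ball_norm in Hd. rewrite E in Hd.
  assert (N := Hslice (w - z)%C).
  assert (Hlt : norm2 (slice t (w - z)) < d).
  { eapply Rle_lt_trans; [exact N|]. apply Rlt_div_r in Hw; lra. }
  specialize (Hd Hlt). cbn [pos] in Hd.
  assert (El : l (slice t (w - z)) = ((w - z) * l (slice t (RtoC 1)))%C).
  { transitivity (l (scal (w - z)%C (slice t (RtoC 1))));
      [f_equal|exact (linear_scal l Hlin (w - z)%C (slice t (RtoC 1)))].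
    unfold slice. apply injective_projections.
    - change (RtoC (/ t) * (w - z) = (w - z) * (RtoC (/ t) * RtoC 1))%C. C_ring.
    - change (w - z = (w - z) * RtoC 1)%C. C_ring. }
  rewrite El in Hd.
  eapply Rle_trans; [exact Hd|].
  change (norm (V := C2) (slice t (w - z))) with (norm2 (slice t (w - z))).
  replace (eps * Cmod (w - z)) with (eps / (/ t + 1) * ((/ t + 1) * Cmod (w - z))) by (field; lra).
  apply Rmult_le_compat_l; lra.
Qed.

(** The coefficient of [1 / z ^ k] in the expansion along [slice t]. *)
Definition homogeneous_part (rho : nat * nat -> C) (t : R) (k : nat) : C :=
  C_poly (fun j => rho (j, (k - j)%nat)) k t.

Lemma expansion_slice (rho : nat * nat -> C) (m : nat) (t : R) (z : C) : 0 < t -> z <> 0%C ->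
  expansion rho m (slice t z) = sum_n (fun k => (homogeneous_part rho t k / z ^ k)%C) m.
Proof.
  intros Ht Hz. unfold expansion. apply sum_n_ext. intros k.
  unfold homogeneous_part, C_poly, Cdiv at 2. rewrite Cmult_comm, <- sum_n_C_scal.
  apply sum_n_ext_loc. intros j Hj. unfold monomial, slice. simpl fst; simpl snd.
  assert (Ht0 : RtoC t <> 0%C) by (intros E; apply RtoC_inj in E; lra).
  replace (z ^ k)%C with (z ^ j * z ^ (k - j))%C by (rewrite <- Cpow_add_r; f_equal; lia).
  rewrite RtoC_inv, Cpow_mult_l, Cpow_inv, RtoC_pow by (auto; lra). C_field.
  repeat split; apply Cpow_nz; assumption.
Qed.

Lemma nt_littleo_slice (f : C2 -> C) m t : 0 < t -> nt_littleo f m ->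
  forall e, 0 < e -> eventually_nt (fun z => Cmod (f (slice t z)) <= e / Cmod z ^ m).
Proof.
  intros Ht H e He.
  apply (eventually_nt_impl (fun z => Cmod (f (slice t z)) <= e * norm (1 / norm2 (slice t z) ^ m))).
  - intros z Hz B. eapply Rle_trans; [exact B|].
    assert (Hz0 : 0 < Cmod z) by (apply Cmod_gt_0, upper_neq_0, Hz).
    destruct (norm2_bounds (slice t z)) as (_ & B2 & _). simpl snd in B2.
    unfold Rdiv. apply Rmult_le_compat_l; [lra|].
    change (norm (1 * / norm2 (slice t z) ^ m)) with (Rabs (1 * / norm2 (slice t z) ^ m)).
    rewrite Rmult_1_l, Rabs_pos_eq by (left; apply Rinv_0_lt_compat, pow_lt; lra).
    apply Rinv_le_contravar; [apply pow_lt, Hz0|]. apply pow_incr. lra.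
  - intros c. apply (nontangential_slice t c (fun z => Cmod (f z) <= e * norm (1 / norm2 z ^ m)) Ht).
    exact (H _ (mkposreal e He)).
Qed.

Lemma nt_bigO_imaginary_axis (f : C2 -> C) (m : nat) (t : R) : 0 < t -> nt_bigO f m ->
  exists K M, forall s, 0 < s -> M < s -> Cmod (f (slice t (RtoC s * Ci)%C)) <= K / s ^ m.
Proof.
  intros Ht H. destruct (H (Rabs 1 * (/ t + 1) * (1 + t))) as [K HK].
  apply (nontangential_slice t 1 _ Ht) in HK. destruct HK as [M HM].
  exists (Rabs K), M. intros s Hs HMs.
  assert (Es : Cmod (RtoC s * Ci) = s) by (rewrite Cmod_mult, Cmod_R, Cmod_Ci, Rabs_pos_eq; lra).
  assert (Ei : Im (RtoC s * Ci) = s) by (rewrite im_scal_l; simpl; ring).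
  assert (B := HM (RtoC s * Ci)%C). unfold upper in B. rewrite Es, Ei in B.
  eapply Rle_trans; [apply B; lra|].
  destruct (norm2_bounds (slice t (RtoC s * Ci)%C)) as (_ & B2 & _). simpl snd in B2. rewrite Es in B2.
  assert (P : / norm2 (slice t (RtoC s * Ci)%C) ^ m <= / s ^ m).
  { apply Rinv_le_contravar; [apply pow_lt, Hs|]. apply pow_incr. lra. }
  assert (Q : 0 < / norm2 (slice t (RtoC s * Ci)%C) ^ m) by (apply Rinv_0_lt_compat, pow_lt; lra).
  unfold Rdiv. rewrite Rmult_1_l.
  apply Rle_trans with (Rabs K * / norm2 (slice t (RtoC s * Ci)%C) ^ m).
  - apply Rmult_le_compat_r; [lra|apply Rle_abs].
  - apply Rmult_le_compat_l; [apply Rabs_pos|exact P].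
Qed.

(** Along [z = i s], the difference of the two expansions up to order [m] is a
    polynomial in [1 / s] that is [O(1 / s ^ (m + 1))]. *)
Lemma homogeneous_part_unique (h : C2 -> C) (m : nat) (rho r : nat * nat -> C) (t : R) :
  0 < t ->
  nt_littleo (fun z => (h z - expansion rho (S m) z)%C) (S m) ->
  nt_bigO (fun z => (h z - expansion r m z)%C) (S m) ->
  forall k, (k <= m)%nat -> homogeneous_part rho t k = homogeneous_part r t k.
Proof.
  intros Ht Ho HO k Hk.
  destruct (nt_bigO_imaginary_axis _ _ t Ht HO) as (K & M1 & HK).
  destruct (nt_littleo_slice _ _ t Ht Ho 1 Rlt_0_1 1) as [M2 H2].
  (* Coefficients with respect to the real variable [x = 1 / s] of [z = i s]. *)
  pose (d := fun k => ((homogeneous_part rho t k - homogeneous_part r t k) * (/ Ci) ^ k)%C).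
  pose (L := Cmod (homogeneous_part rho t (S m))).
  assert (HCi : Ci <> 0%C) by (intros E; apply (f_equal snd) in E; simpl in E; lra).
  assert (Hd : d k = 0%C).
  { apply (C_poly_small_zero d m (Rabs K + 1 + L) (/ (1 + Rabs M1 + Rabs M2))); [| | |exact Hk].
    - assert (A := Rabs_pos M1). assert (B := Rabs_pos M2). split.
      + apply Rinv_0_lt_compat. lra.
      + rewrite <- Rinv_1. apply Rinv_le_contravar; lra.
    - assert (A := Rabs_pos K). assert (B := Cmod_ge_0 (homogeneous_part rho t (S m))). unfold L. lra.
    - intros x [Hx0 Hx1].
      assert (A1 := Rabs_pos M1). assert (A2 := Rabs_pos M2).
      assert (A3 := Rle_abs M1). assert (A4 := Rle_abs M2).
      pose (s := / x).
      assert (Hs : 0 < s) by (apply Rinv_0_lt_compat, Hx0).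
      assert (Hs1 : 1 + Rabs M1 + Rabs M2 < s).
      { unfold s. rewrite <- (Rinv_inv (1 + Rabs M1 + Rabs M2)). apply Rinv_lt_contravar; [|exact Hx1].
        apply Rmult_lt_0_compat; [exact Hx0|]. apply Rinv_0_lt_compat. lra. }
      assert (Es : Cmod (RtoC s * Ci) = s) by (rewrite Cmod_mult, Cmod_R, Cmod_Ci, Rabs_pos_eq; lra).
      assert (Ei : Im (RtoC s * Ci) = s) by (rewrite im_scal_l; simpl; ring).
      assert (Hs0 : RtoC s <> 0%C) by (intros E; apply RtoC_inj in E; lra).
      specialize (HK s Hs ltac:(lra)).
      specialize (H2 (RtoC s * Ci)%C). unfold upper in H2. rewrite Es, Ei in H2.
      specialize (H2 Hs ltac:(lra) ltac:(lra)). cbv beta in HK, H2.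
      set (z := (RtoC s * Ci)%C) in *.
      assert (Hz0 : z <> 0%C) by (apply Cmult_neq_0; assumption).
      rewrite expansion_slice in HK, H2 by assumption.
      rewrite sum_n_C_S in H2.
      set (hz := h (slice t z)) in *.
      set (Sr := sum_n (fun k => (homogeneous_part r t k / z ^ k)%C) m) in *.
      set (Srho := sum_n (fun k => (homogeneous_part rho t k / z ^ k)%C) m) in *.
      assert (E : C_poly d m x = (Srho - Sr)%C).
      { unfold Srho, Sr. rewrite <- sum_n_C_minus. apply sum_n_ext. intros j. unfold d.
        replace (RtoC (x ^ j)) with (/ (RtoC s ^ j))%C.
        - unfold z. rewrite Cpow_mult_l, Cpow_inv by exact HCi. C_field.
          split; apply Cpow_nz; assumption.
        - rewrite <- RtoC_pow, <- RtoC_inv by (apply pow_nonzero; lra). f_equal. unfold s. rewrite pow_inv, Rinv_inv. reflexivity. }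
      rewrite E.
      set (q := (homogeneous_part rho t (S m) / z ^ S m)%C) in *.
      assert (Hq : Cmod q = L * / s ^ S m).
      { unfold q, L. rewrite Cmod_div by (apply Cpow_nz, Hz0). rewrite Cmod_pow, Es. reflexivity. }
      replace (Srho - Sr)%C with ((hz - Sr) + - (hz - (Srho + q)) + - q)%C by ring.
      assert (T1 := Cmod_triangle ((hz - Sr) + - (hz - (Srho + q))) (- q)).
      assert (T2 := Cmod_triangle (hz - Sr) (- (hz - (Srho + q)))).
      rewrite !Cmod_opp in T1. rewrite !Cmod_opp in T2.
      replace (x ^ S m) with (/ s ^ S m) by (unfold s; rewrite pow_inv, Rinv_inv; reflexivity).
      assert (0 < / s ^ S m) by (apply Rinv_0_lt_compat, pow_lt, Hs).
      assert (K * / s ^ S m <= Rabs K * / s ^ S m) by (apply Rmult_le_compat_r; [lra|apply Rle_abs]).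
      unfold Rdiv in HK, H2. rewrite Hq in T1. lra. }
  unfold d in Hd.
  destruct (Ceq_dec (homogeneous_part rho t k - homogeneous_part r t k) 0) as [E|E].
  - replace (homogeneous_part rho t k) with (homogeneous_part rho t k - homogeneous_part r t k + homogeneous_part r t k)%C by ring.
    rewrite E. ring.
  - exfalso. revert Hd. apply Cmult_neq_0; [exact E|]. apply Cpow_nz. intros E'.
    apply (Cmult_neq_0 Ci (/ Ci)%C); [exact HCi| |].
    + intros E2. assert (F : (Ci * / Ci)%C = 1%C) by (apply Cinv_r; exact HCi).
      rewrite E2, Cmult_0_r in F. apply (f_equal fst) in F. simpl in F. lra.
    + rewrite E'. ring.
Qed.

Lemma Im_C_poly (d : nat -> C) (m : nat) (t : R) :
  RtoC (Im (C_poly d m t)) = C_poly (fun k => RtoC (Im (d k))) m t.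
Proof.
  unfold C_poly. induction m as [|m IH].
  - rewrite !sum_O, im_scal_r, RtoC_mult. reflexivity.
  - rewrite !sum_n_C_S, im_plus, RtoC_plus, IH, im_scal_r, RtoC_mult. reflexivity.
Qed.

Lemma Im_C_poly_real (d : nat -> R) (m : nat) (t : R) :
  Im (C_poly (fun j => RtoC (d j)) m t) = 0.
Proof.
  unfold C_poly. induction m as [|m IH].
  - rewrite sum_O, <- RtoC_mult. reflexivity.
  - rewrite sum_n_C_S, im_plus, IH, <- RtoC_mult, im_RtoC. ring.
Qed.

Lemma coefficients_real (rho : nat * nat -> C) (k : nat) :
  (forall t, 0 < t -> Im (homogeneous_part rho t k) = 0) ->
  forall j, (j <= k)%nat -> Im (rho (j, (k - j)%nat)) = 0.
Proof.
  intros H j Hj. apply RtoC_inj.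
  apply (C_poly_small_zero (fun j => RtoC (Im (rho (j, (k - j)%nat)))) k 0 1); [lra|lra| |exact Hj].
  intros t Ht. rewrite <- Im_C_poly. change (C_poly _ k t) with (homogeneous_part rho t k).
  rewrite H by lra. rewrite Cmod_0. lra.
Qed.

(** The one-variable theorem applies to [z |-> h (slice t z) - R_0]; the real
    constant [R_0] does not change the imaginary part. *)
Lemma homogeneous_parts_real (h : C2 -> C) (n : nat) (rho : nat * nat -> C) (r : nat * nat -> R) (t : R) :
  Pick2 h -> 0 < t ->
  nt_littleo (fun z => (h z - expansion rho (S (2 * n)) z)%C) (S (2 * n)) ->
  nt_bigO (fun z => (h z - expansion (fun n => RtoC (r n)) (2 * n) z)%C) (S (2 * n)) ->
  forall k, (k <= S (2 * n))%nat -> Im (homogeneous_part rho t k) = 0.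
Proof.
  intros Hh Ht Ho HO.
  assert (low : forall k, (k <= 2 * n)%nat -> Im (homogeneous_part rho t k) = 0).
  { intros k Hk. rewrite (homogeneous_part_unique h (2 * n) rho (fun n => RtoC (r n)) t Ht Ho HO k Hk).
    apply Im_C_poly_real. }
  intros k Hk. destruct (Nat.eq_dec k (S (2 * n))) as [->|Hne]; [|apply low; lia].
  pose (Rk := fun k => Re (homogeneous_part rho t k)).
  assert (HRk : forall k, (k <= 2 * n)%nat -> homogeneous_part rho t k = RtoC (Rk k)).
  { intros j Hj. apply injective_projections; [reflexivity|]. exact (low j Hj). }
  pose (f := fun z : C => (h (slice t z) + RtoC (- Rk O))%C).
  apply (hamburger_last_coefficient_real n (fun k => Rk (S k)) f).
  - intros z Hz. unfold f. holo_tac. apply holo_slice; assumption.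
  - intros z Hz. unfold f. rewrite im_plus, im_RtoC, Rplus_0_r. left.
    apply (Hh (slice t z)), upper2_slice; assumption.
  - intros e He.
    apply (eventually_nt_impl (fun z => Cmod (h (slice t z) - expansion rho (S (2 * n)) (slice t z))
       <= e / Cmod z ^ S (2 * n))).
    + intros z Hz B. assert (Hz0 := upper_neq_0 z Hz).
      assert (Hzm : 0 < Cmod z ^ S (2 * n)) by (apply pow_lt, Cmod_gt_0, Hz0).
      rewrite hamburger_tail_formula, expansion_slice in * by assumption.
      rewrite sum_n_C_S in B.
      rewrite (sum_n_ext_loc _ (fun k => (RtoC (Rk k) / z ^ k)%C)) in B
        by (intros j Hj; rewrite HRk by exact Hj; reflexivity).
      apply Rle_div_r in B; [|exact Hzm].
      rewrite <- Cmod_pow, <- Cmod_mult in B.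
      match goal with |- Cmod ?u <= _ => match type of B with Cmod ?v <= _ => replace u with v; [exact B|] end end.
      unfold f. rewrite RtoC_opp. rewrite !Cpow_S. field. split; [apply Cpow_nz|]; exact Hz0.
    + apply (nt_littleo_slice _ _ t Ht Ho e He).
Qed.

Lemma expansion_ext (rho r : nat * nat -> C) (m : nat) (z : C2) :
  (forall k j, (k <= m)%nat -> (j <= k)%nat -> rho (j, (k - j)%nat) = r (j, (k - j)%nat)) ->
  expansion rho m z = expansion r m z.
Proof.
  intros H. unfold expansion. apply sum_n_ext_loc. intros k Hk. apply sum_n_ext_loc. intros j Hj.
  rewrite H by assumption. reflexivity.
Qed.

(** In a nontangential region the modulus of each coordinate is at least its
    imaginary part, hence at least [norm2 z / c]. *)
Lemma monomial_lower_bound (c : R) (z : C2) (j l : nat) : nontangential_region c z ->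
  0 < c /\ 0 < norm2 z /\ (norm2 z / c) ^ (j + l) <= Cmod (monomial z (j, l)).
Proof.
  intros [[H1 H2] H]. unfold upper in *.
  destruct (norm2_bounds z) as (B1 & B2 & _).
  assert (D1 := im_le_Cmod (fst z)). assert (D2 := im_le_Cmod (snd z)).
  rewrite Rabs_pos_eq in D1, D2 by lra.
  assert (M1 := Rmin_l (Im (fst z)) (Im (snd z))). assert (M2 := Rmin_r (Im (fst z)) (Im (snd z))).
  assert (M3 : 0 < Rmin (Im (fst z)) (Im (snd z))) by (apply Rmin_pos; assumption).
  assert (Hc : 0 < c).
  { apply Rnot_le_lt. intros Hc. nra. }
  assert (Hn : 0 < norm2 z) by lra.
  assert (Hnc : norm2 z / c <= Rmin (Im (fst z)) (Im (snd z))) by (apply Rle_div_l; lra).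
  assert (Hnc0 : 0 < norm2 z / c) by (apply Rdiv_lt_0_compat; assumption).
  split; [exact Hc|split; [exact Hn|]].
  unfold monomial. simpl fst; simpl snd. rewrite Cmod_mult, !Cmod_pow, pow_add.
  assert (E1 := Rle_trans _ _ _ Hnc (Rle_trans _ _ _ M1 D1)).
  assert (E2 := Rle_trans _ _ _ Hnc (Rle_trans _ _ _ M2 D2)).
  apply Rmult_le_compat; try (left; apply pow_lt; exact Hnc0); apply pow_incr;
    (split; [left; exact Hnc0|assumption]).
Qed.

Lemma homogeneous_term_bigO (c : R) (rho : nat * nat -> C) (m : nat) :
  exists L, forall z, nontangential_region c z ->
    Cmod (sum_n (fun j => (rho (j, (m - j)%nat) / monomial z (j, (m - j)%nat))%C) m) <= L / norm2 z ^ m.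
Proof.
  assert (gen : forall k, (k <= m)%nat -> exists L, forall z, nontangential_region c z ->
    Cmod (sum_n (fun j => (rho (j, (m - j)%nat) / monomial z (j, (m - j)%nat))%C) k) <= L / norm2 z ^ m).
  { assert (term : forall j z, (j <= m)%nat -> nontangential_region c z ->
      Cmod (rho (j, (m - j)%nat) / monomial z (j, (m - j)%nat)) <= Cmod (rho (j, (m - j)%nat)) * c ^ m / norm2 z ^ m).
    { intros j z Hj Hz. destruct (monomial_lower_bound c z j (m - j) Hz) as (Hc & Hn & B).
      replace (j + (m - j))%nat with m in B by lia.
      assert (P : 0 < (norm2 z / c) ^ m) by (apply pow_lt, Rdiv_lt_0_compat; assumption).
      rewrite Cmod_div by (apply Cmod_gt_0; lra).
      unfold Rdiv. rewrite Rmult_assoc. apply Rmult_le_compat_l; [apply Cmod_ge_0|].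
      apply Rle_trans with (/ (norm2 z / c) ^ m); [apply Rinv_le_contravar; assumption|].
      right. unfold Rdiv. rewrite Rpow_mult_distr, pow_inv. field.
      split; apply pow_nonzero; lra. }
    induction k as [|k IH]; intros Hk.
    - eexists. intros z Hz. rewrite sum_O. apply term; [lia|exact Hz].
    - destruct (IH ltac:(lia)) as [L HL].
      exists (L + Cmod (rho (S k, (m - S k)%nat)) * c ^ m). intros z Hz. rewrite sum_n_C_S.
      eapply Rle_trans; [apply Cmod_triangle|]. rewrite Rdiv_plus_distr.
      apply Rplus_le_compat; [apply HL, Hz|apply term; [exact Hk|exact Hz]]. }
  exact (gen m (Nat.le_refl m)).
Qed.

Lemma expansion_truncate (h : C2 -> C) (m : nat) (rho : nat * nat -> C) :
  nt_littleo (fun z => (h z - expansion rho (S m) z)%C) (S m) ->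
  nt_bigO (fun z => (h z - expansion rho m z)%C) (S m).
Proof.
  intros Ho c.
  destruct (homogeneous_term_bigO c rho (S m)) as [L HL].
  exists (1 + L).
  destruct (Ho c (mkposreal 1 Rlt_0_1)) as [M HM]. exists M. intros z Hbig Hz.
  specialize (HM z Hbig Hz). specialize (HL z Hz). cbn [pos] in HM.
  destruct (monomial_lower_bound c z 0 0 Hz) as (_ & Hn & _).
  change (norm (V := R_NormedModule) (1 / norm2 z ^ S m)) with (Rabs (1 / norm2 z ^ S m)) in HM.
  assert (P : 0 < 1 / norm2 z ^ S m) by (apply Rdiv_lt_0_compat; [lra|apply pow_lt, Hn]).
  rewrite Rabs_pos_eq in HM by lra.
  change (Cmod (h z - expansion rho (S m) z) <= 1 * (1 / norm2 z ^ S m)) in HM.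
  set (q := sum_n (fun j => (rho (j, (S m - j)%nat) / monomial z (j, (S m - j)%nat))%C) (S m)) in *.
  assert (E : expansion rho (S m) z = (expansion rho m z + q)%C) by exact (sum_n_C_S _ m).
  rewrite E in HM.
  replace (h z - expansion rho m z)%C with (h z - (expansion rho m z + q) + q)%C by ring.
  eapply Rle_trans; [apply Cmod_triangle|]. unfold Rdiv in *. lra.
Qed.

Theorem theorem1p8 (N : nat) (hN : (1 <= N)%nat) (h : C2 -> C) (hh : Pick2 h) :
  Loewner N h <->
  (LoewnerMinus N h /\
   exists rho : nat * nat -> C,
     nt_littleo (fun z => (h z - expansion rho (2 * N - 1) z)%C) (2 * N - 1)).
Proof.
  destruct N as [|n]; [lia|]. unfold Loewner, LoewnerMinus.
  replace (2 * S n - 1)%nat with (S (2 * n)) by lia.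
  replace (2 * S n - 2)%nat with (2 * n)%nat by lia.
  split.
  - intros (_ & Hv & rho & Ho). split.
    + split; [exact hh|split; [exact Hv|]]. exists rho. apply expansion_truncate, Ho.
    + exists (fun n => RtoC (rho n)). exact Ho.
  - intros [(_ & Hv & r & HO) [rho Ho]].
    split; [exact hh|split; [exact Hv|]].
    exists (fun n => Re (rho n)).
    assert (E : forall z, expansion (fun n => RtoC (Re (rho n))) (S (2 * n)) z = expansion rho (S (2 * n)) z).
    { intros z. apply expansion_ext. intros k j Hk Hj. apply injective_projections; [reflexivity|].
      symmetry. apply (coefficients_real rho k); [|exact Hj]. intros t Ht.
      apply (homogeneous_parts_real h n rho r t hh Ht Ho HO k Hk). }
    intros c eps. destruct (Ho c eps) as [M HM]. exists M. intros z Hbig Hz.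
    rewrite E. exact (HM z Hbig Hz).
Qed.
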